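(* In a neighbourhood of the origin of $\mathbb R^n$ with coordinates $u^1,\dots,u^n$, consider the Nijenhuis operators given by the upper triangular Toeplitz matrices $$N=\begin{pmatrix}0&1&0&\dots&0\\0&0&1&\dots&0\\\vdots&\vdots&\ddots&\ddots&\\0&0&\dots&0&1\\0&0&\dots&0&0\end{pmatrix},\qquad U=\begin{pmatrix}u^n&u^{n-1}&u^{n-2}&\dots&u^1\\0&u^n&u^{n-1}&\dots&u^2\\0&0&u^n&\dots&u^3\\\vdots&\vdots&\ddots&\ddots&\vdots\\0&0&\dots&0&u^n\end{pmatrix}.$$ Every symmetry of $U$ is a symmetry of $N$ and vice versa. These symmetries $M$ are parametrised by $n$ arbitrary smooth functions $f_1,f_2,\dots,f_n$ of one variable defined in a neighbourhood of $0\in\mathbb R$ and take the form $$M=f_1(U)N^{n-1}+f_2(U)N^{n-2}+\dots+f_n(U).$$ Similarly, each conservation law of $U$ is a conservation law of $N$ and vice versa. Moreover, for any such symmetry $M$, let $f(u)=M^1_n$ be the element of $M$ in the right upper corner; then $\mathrm{d}f$ is a conservation law (of $N$ and of $U$), and every conservation law can be obtained in this way.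
   Context: All objects are smooth and all statements are local near the origin (neighbourhoods may be shrunk). Operator fields (fields of endomorphisms of the tangent bundle) are identified with their matrices in the coordinates $u^1,\dots,u^n$, with $L\,\partial_j=\sum_i L^i_j\partial_i$. For a 1-form $\alpha$, $(L^*\alpha)(\xi)=\alpha(L\xi)$. Functions of $U$: for a smooth function $h$ of one variable defined near $0$, $$h(U)=h_n\,\mathrm{Id}+h_{n-1}N+h_{n-2}N^2+\dots+h_1N^{n-1},$$ where the functions $h_i$ of $u^1,\dots,u^n$ are defined from the Taylor expansion in $\lambda$ at $\lambda=0$: $$h\bigl(u^n+\lambda u^{n-1}+\dots+\lambda^{n-1}u^1\bigr)=h_n+\lambda h_{n-1}+\dots+\lambda^{n-1}h_1+\{\text{terms with }\lambda^i,\ i\ge n\}.$$ Symmetry: for commuting operator fields $L,M$ put $\langle L,M\rangle(\xi,\eta)=M[L\xi,\eta]+L[\xi,M\eta]-[L\xi,M\eta]-LM[\xi,\eta]$; $M$ is a symmetry of $L$ if $LM=ML$ and $\langle L,M\rangle(\xi,\xi)=0$ for all vector fields $\xi$. Conservation law of $L$: a closed 1-form $\mathrm{d}f$ such that $\mathrm{d}(L^*\mathrm{d}f)=0$. *)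

(* Defs.v *)
From HB Require Import structures.
From mathcomp Require Import all_boot all_order all_algebra.
From mathcomp Require Import all_classical all_reals all_analysis.
Import Order.TTheory GRing.Theory Num.Theory.
Import numFieldNormedType.Exports.

Set Implicit Arguments.
Unset Strict Implicit.
Unset Printing Implicit Defensive.

Local Open Scope ring_scope.
Local Open Scope classical_set_scope.

(* Points and tangent vectors of R^n are column vectors, 1-forms take values in
   row vectors, and an operator field L acts by L u *m xi u on vector fields
   and by alpha u *m L u on 1-forms.  The coordinate u^k is [u i 0] where
   [i : 'I_n] has value k.-1.  All fields are total functions, only their
   values on the open set W under consideration matter. *)

(* [near_origin P]: P holds on some open neighbourhood of the origin. *)
Definition near_origin (R : realType) (V : normedModType R)
    (P : set V -> Prop) : Prop :=
  exists2 W : set V, open_nbhs 0 W & P W.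

(* f is C^k on W: in finite dimension this is the usual existence and
   continuity of all partial derivatives up to order k. *)
Fixpoint Ck_on (R : realType) (V W : normedModType R) (k : nat) (A : set V)
    (f : V -> W) : Prop :=
  (forall u, A u -> {for u, continuous f}) /\
  (if k is k'.+1 then
     forall v, (forall u, A u -> derivable f u v) /\ Ck_on k' A ('D_v f)
   else True).

Definition smooth_on (R : realType) (V W : normedModType R) (A : set V)
    (f : V -> W) : Prop :=
  forall k, Ck_on k A f.

Section Fields.
Variables (R : realType) (n : nat).
Implicit Types (W : set 'cV[R]_n) (xi eta : 'cV[R]_n -> 'cV[R]_n).
Implicit Types (L M : 'cV[R]_n -> 'M[R]_n) (alpha : 'cV[R]_n -> 'rV[R]_n).

Definition partial (i : 'I_n) (f : 'cV[R]_n -> R) : 'cV[R]_n -> R :=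
  'D_(delta_mx i 0) f.

(* [xi, eta]^i = sum_j (xi^j d_j eta^i - eta^j d_j xi^i) *)
Definition lie_bracket xi eta : 'cV[R]_n -> 'cV[R]_n :=
  fun u => 'D_(xi u) eta u - 'D_(eta u) xi u.

Definition op_app L xi : 'cV[R]_n -> 'cV[R]_n := fun u => L u *m xi u.

Definition sym_bracket L M xi eta : 'cV[R]_n -> 'cV[R]_n := fun u =>
  M u *m lie_bracket (op_app L xi) eta u
  + L u *m lie_bracket xi (op_app M eta) u
  - lie_bracket (op_app L xi) (op_app M eta) u
  - (L u *m M u) *m lie_bracket xi eta u.

Definition symmetry_on L M W : Prop :=
  [/\ smooth_on W M,
      (forall u, W u -> L u *m M u = M u *m L u) &
      (forall xi, smooth_on W xi ->
         forall u, W u -> sym_bracket L M xi xi u = 0)].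

Definition symmetry L M : Prop := near_origin (symmetry_on L M).

Definition dform (f : 'cV[R]_n -> R) : 'cV[R]_n -> 'rV[R]_n :=
  fun u => \row_j partial j f u.

Definition closed_form_on alpha W : Prop :=
  forall u, W u -> forall i j : 'I_n,
    partial i (fun x => alpha x 0 j) u = partial j (fun x => alpha x 0 i) u.

(* the action L^* on 1-forms *)
Definition op_dual L alpha : 'cV[R]_n -> 'rV[R]_n := fun u => alpha u *m L u.

Definition conservation_law_on L alpha W : Prop :=
  [/\ (exists2 f : 'cV[R]_n -> R,
         smooth_on W f & forall u, W u -> alpha u = dform f u),
      closed_form_on alpha W &
      closed_form_on (op_dual L alpha) W].

Definition conservation_law L alpha : Prop :=
  near_origin (conservation_law_on L alpha).

Definition shift_mx : 'M[R]_n := \matrix_(i, j) (j == i.+1 :> nat)%:R.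

Definition opN : 'cV[R]_n -> 'M[R]_n := fun=> shift_mx.

Definition taylor_coef (g : R -> R) (i : nat) : R := derive1n i g 0 / i`!%:R.

(* u^n + l u^(n-1) + ... + l^(n-1) u^1 *)
Definition coord_poly (u : 'cV[R]_n) (l : R) : R :=
  \sum_(i < n) l ^+ i * u (rev_ord i) 0.

(* h(U); the coefficient h_(n-i) of N^i is the i-th Taylor coefficient. *)
Definition fun_of_U (h : R -> R) : 'cV[R]_n -> 'M[R]_n := fun u =>
  \sum_(i < n) taylor_coef (fun l => h (coord_poly u l)) i *: shift_mx ^+ i.

(* f_1(U) N^(n-1) + ... + f_n(U), with f_k stored at the index of value k.-1 *)
Definition sym_of (f : 'I_n -> R -> R) : 'cV[R]_n -> 'M[R]_n := fun u =>
  \sum_(i < n) fun_of_U (f i) u *m shift_mx ^+ (n - i.+1).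

End Fields.

Arguments opN : clear implicits.

(* The dimension is n.+1: the diagonal i = j carries the last coordinate and
   the upper right corner the first one. *)
Definition opU (R : realType) (n : nat) : 'cV[R]_n.+1 -> 'M[R]_n.+1 := fun u =>
  \matrix_(i, j) if (i <= j)%N then u (inord (n - (j - i))) 0 else 0.

Arguments opU : clear implicits.

(* Main.v *)
Require Import Defs.
From HB Require Import structures.
From mathcomp Require Import all_boot all_order all_algebra.
From mathcomp Require Import all_classical all_reals all_analysis.
From mathcomp Require Import zify ring.
Import Order.TTheory GRing.Theory Num.Theory.
Import numFieldNormedType.Exports.

(* Let A = R[N] be the commutative algebra of upper triangular Toeplitz
   matrices.  The map u |-> U(u) identifies R^n with A, and away from the thin
   set u^(n-1) = 0 the matrix U(u) generates A.  For M with values in A, the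
   condition <L, M>(xi, xi) = 0 with L = N or L = U reduces to
   D_(L v) M = L (D_v M), so by density the symmetries of N and those of U are
   both the maps M into A that are holomorphic over A: D_v M = U(v) D_e M,
   where e is the last basis vector, U(e) = 1.
   The derivative of h(U) along v is h'(U) U(v), because
   h(U) = sum_k h^(k)(u^n)/k! (U - u^n)^k; so f_1(U) N^(n-1) + ... + f_n(U) is
   holomorphic.  Conversely a holomorphic map is determined near 0 by its
   values on the line R e, where f_1(U) N^(n-1) + ... takes the value
   f_1(s) N^(n-1) + ... + f_n(s).
   A closed form alpha = df is a conservation law of L iff H L is symmetric, H
   being the Hessian of f; this again only depends on the algebra generated by
   L.  For L = N it means that alpha, read backwards as an element of A, is
   holomorphic, hence equal to h_1(U) N^(n-1) + ... + h_n(U); replacing the h_i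
   by antiderivatives yields M with d(M^1_n) = alpha. *)

Set Implicit Arguments.
Unset Strict Implicit.
Unset Printing Implicit Defensive.

Local Open Scope ring_scope.
Local Open Scope classical_set_scope.

(** * Directional derivatives and smooth maps *)

Section MatrixDerivative.
Variables (R : realType) (V : normedModType R).

Lemma is_derive_mxP m n (M : V -> 'M[R]_(m, n)) u v dM :
  is_derive u v M dM <->
  forall i j, is_derive u v (fun x => M x i j) (dM i j).
Proof.
split=> [[Mv <-] i j|Mv].
  split; first by move/derivable_mxP: Mv; apply.
  by rewrite derive_mx// mxE.
have dMv : derivable M u v by apply/derivable_mxP => i j; case: (Mv i j).
split=> //; rewrite derive_mx//; apply/matrixP => i j; rewrite mxE.
exact: derive_val.
Qed.

Lemma is_derive_mulmx m n p (A : V -> 'M[R]_(m, n)) (B : V -> 'M[R]_(n, p))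
    u v dA dB :
  is_derive u v A dA -> is_derive u v B dB ->
  is_derive u v (fun x => A x *m B x) (dA *m B u + A u *m dB).
Proof.
move=> /is_derive_mxP Av /is_derive_mxP Bv; apply/is_derive_mxP => i j.
pose h (k : 'I_n) : V -> R := (fun x => A x i k) * (fun x => B x k j).
have -> : (fun x => (A x *m B x) i j) = \sum_k h k.
  by apply/funext => x; rewrite mxE fct_sumE.
have hv k : is_derive u v (h k) (A u i k *: dB k j + B u k j *: dA i k).
  exact: is_deriveM (Av i k) (Bv k j).
apply: is_derive_eq (is_derive_sum hv) _.
transitivity (\sum_k (dA i k * B u k j + A u i k * dB k j)).
  by apply: eq_bigr => k _; rewrite /GRing.scale/= addrC mulrC.
by rewrite big_split !mxE.
Qed.

(** Expanding the argument in the basis [delta_mx i j] writes [phi] as a finite sum of coordinate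
    functions times fixed vectors. *)
Lemma mx_linear_continuous m n (W : normedModType R)
    (phi : {linear 'M[R]_(m, n) -> W}) : continuous phi.
Proof.
have -> : (phi : _ -> _) =
    fun M : 'M[R]_(m, n) => \sum_i \sum_j M i j *: phi (delta_mx i j).
  apply/funext => M; rewrite [in LHS](matrix_sum_delta M) linear_sum.
  by apply: eq_bigr => i _; rewrite linear_sum; apply: eq_bigr => j _; rewrite linearZ.
apply: continuous_big => [|i _]; first exact: add_continuous.
apply: continuous_big => [|j _ M]; first exact: add_continuous.
apply: (@continuous_comp _ _ _ (fun M : 'M[R]_(m, n) => M i j)
  ( *:%R^~ (phi (delta_mx i j)))); first exact: coord_continuous.
exact: scalel_continuous.
Qed.

Lemma is_derive_linear (W W' : normedModType R) (phi : {linear W -> W'})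
    (f : V -> W) u v df : continuous phi ->
  is_derive u v f df -> is_derive u v (fun x => phi (f x)) (phi df).
Proof.
move=> cphi [fv <-]; suff cv : h^-1 *: (((phi \o f) \o shift u) (h *: v) -
    (phi \o f) u) @[h --> 0^'] --> phi ('D_v f u).
  by split; [apply/cvg_ex; exists (phi ('D_v f u)) | exact: cvg_lim cv].
have -> : (fun h : R => h^-1 *: (((phi \o f) \o shift u) (h *: v) -
    (phi \o f) u)) = phi \o (fun h : R => h^-1 *: ((f \o shift u) (h *: v) - f u)).
  by apply/funext => h /=; rewrite linearZ/= (linearB phi).
by apply: cvg_comp; [exact: fv | exact: cphi].
Qed.

(** It is enough that [l] is affine along the one line through [u]: both difference quotients are
    then the same function of [h]. *)
Lemma is_derive_precomp (V' W : normedModType R) (l : V' -> V)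
    (f : V -> W) u v w df : (forall h : R, l (h *: v + u) = h *: w + l u) ->
  is_derive (l u) w f df -> is_derive u v (fun x => f (l x)) df.
Proof.
move=> lE.
have E : (fun h : R => h^-1 *: (((f \o l) \o shift u) (h *: v) - (f \o l) u)) =
    (fun h : R => h^-1 *: ((f \o shift (l u)) (h *: w) - f (l u))).
  by apply/funext => h /=; rewrite lE.
by case=> fv dfE; split; rewrite /derivable /derive E.
Qed.

(** For [c != 0], replacing [h] by [h * c] in the difference quotient respects the punctured
    neighbourhoods of 0. *)
Lemma is_derive_dirZ (W : normedModType R) (f : V -> W) u v df (c : R) :
  is_derive u v f df -> is_derive u (c *: v) f (c *: df).
Proof.
have [->|c0] := eqVneq c 0; first by rewrite !scale0r => _; exact: is_derive0.
move=> [fv <-].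
suff cv : h^-1 *: ((f \o shift u) (h *: (c *: v)) - f u)
    @[h --> 0^'] --> c *: 'D_v f u.
  by split; [apply/cvg_ex; exists (c *: 'D_v f u) | exact: cvg_lim cv].
have -> : (fun h : R => h^-1 *: ((f \o shift u) (h *: (c *: v)) - f u)) =
   (fun h : R => c *: ((fun h => h^-1 *: ((f \o shift u) (h *: v) - f u)) (h * c))).
  apply/funext => h /=; rewrite !scalerA; congr (_ *: _).
  by rewrite invfM mulrCA divff// mulr1.
have hc : h * c @[h --> (0 : R)^'] --> (0 : R)^'.
  move=> S [e e0 Se]; exists (e / `|c|); first by rewrite /= divr_gt0 ?normr_gt0.
  move=> h /= he h0; apply: Se; last by rewrite mulf_neq0.
  by move: he; rewrite /ball_/= !sub0r !normrN normrM ltr_pdivlMr ?normr_gt0.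
by apply: cvgZl_tmp; exact: (cvg_comp _ _ hc fv).
Qed.

(** The one-variable mean value theorem for [t |-> f (u + t *: v)]. *)
Lemma segment_MVT (f : V -> R) u v :
  (forall t : R, 0 <= t <= 1 -> derivable f (u + t *: v) v) ->
  exists2 t : R, 0 <= t <= 1 & f (u + v) - f u = 'D_v f (u + t *: v).
Proof.
move=> fv; pose g (t : R) : R := f (u + t *: v).
have gd (t : R) : 0 <= t <= 1 -> is_derive t (1 : R) g ('D_v f (u + t *: v)).
  move=> t01; have /derivableP fvt := fv _ t01.
  have E : (fun h : R => h^-1 *: ((g \o shift t) (h *: 1) - g t)) =
     (fun h : R => h^-1 *: ((f \o shift (u + t *: v)) (h *: v) - f (u + t *: v))).
    by apply/funext => h; rewrite /g/= [h *: 1]mulr1 scalerDl addrCA.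
  by case: fvt => fvt _; split; rewrite /derivable /derive E.
have [|||t t01] := @MVT_segment R g (fun t => 'D_v f (u + t *: v)) 0 1.
- exact: ler01.
- by move=> t; rewrite in_itv/= => /andP[t0 t1]; apply: gd; rewrite !ltW.
- apply: derivable_within_continuous => t; rewrite in_itv/= => t01.
  by case: (gd t t01).
rewrite /g scale1r scale0r addr0 subr0 mulr1 => ->.
by exists t => //; rewrite in_itv/= in t01.
Qed.

End MatrixDerivative.

(** * Closure properties of C^k and smooth maps *)

Section CkClosure.
Variables (R : realType) (V W : normedModType R).
Implicit Types (A B : set V) (f g : V -> W) (k : nat).

Lemma Ck_on_continuous k A f : Ck_on k A f -> forall u, A u -> {for u, continuous f}.
Proof. by case: k => [|k] []. Qed.

Lemma Ck_on_sub k A B f : A `<=` B -> Ck_on k B f -> Ck_on k A f.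
Proof.
move=> AB; elim: k f => [|k IH] f [fc fd];
  (split; first by move=> u /AB/fc) => // v.
by have [fv Df] := fd v; split=> [u /AB/fv//|]; exact: IH.
Qed.

Lemma open_near_eq A f g : open A -> (forall u, A u -> f u = g u) ->
  forall u, A u -> {near u, f =1 g}.
Proof.
by move=> oA fg u Au; apply: filterS (open_nbhs_nbhs (conj oA Au)); exact: fg.
Qed.

Lemma open_eq_continuous A f g u : open A -> (forall u, A u -> f u = g u) ->
  A u -> {for u, continuous f} -> {for u, continuous g}.
Proof.
move=> oA fg Au fu; have gu : g x @[x --> u] --> f u.
  exact: cvg_trans (near_eq_cvg (open_near_eq oA fg Au)) fu.
by rewrite fg in gu.
Qed.

Lemma Ck_on_eq k A f g : open A -> (forall u, A u -> f u = g u) ->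
  Ck_on k A f -> Ck_on k A g.
Proof.
move=> oA; elim: k f g => [|k IH] f g fg [fc fd];
  have fgn := open_near_eq oA fg; (split;
  first by move=> u Au; exact: open_eq_continuous oA fg Au (fc u Au)) => // v.
have [fv Df] := fd v; split=> [u Au|].
  by apply: near_eq_derivable (fv _ Au); exact: fgn.
by apply: IH Df => u Au; apply: near_eq_derive; exact: fgn.
Qed.

Lemma smooth_on_sub A B f : A `<=` B -> smooth_on B f -> smooth_on A f.
Proof. by move=> AB sf k; exact: Ck_on_sub (sf k). Qed.

Lemma smooth_on_eq A f g : open A -> (forall u, A u -> f u = g u) ->
  smooth_on A f -> smooth_on A g.
Proof. by move=> oA fg sf k; exact: Ck_on_eq (sf k). Qed.

Lemma smooth_on_continuous A f u : smooth_on A f -> A u -> {for u, continuous f}.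
Proof. by move=> sf; exact: Ck_on_continuous (sf 0%N) u. Qed.

Lemma smooth_on_derivable A f u v : smooth_on A f -> A u -> derivable f u v.
Proof. by move=> sf Au; have [_ /(_ v)[fv _]] := sf 1%N; exact: fv. Qed.

Lemma smooth_on_derive A f v : smooth_on A f -> smooth_on A ('D_v f).
Proof. by move=> sf k; have [_ /(_ v)[_]] := sf k.+1. Qed.

Lemma smooth_on_cst A (c : W) : smooth_on A (cst c).
Proof.
move=> k; elim: k c => [|k IH] c; (split; first by move=> u _; exact: cst_continuous) => // v.
split=> [u _|]; first exact: derivable_cst.
by rewrite (_ : 'D_v _ = cst 0)//; apply/funext => u; exact: derive_cst.
Qed.

End CkClosure.

Section CkComposition.
Variables (R : realType) (V W : normedModType R).

Lemma Ck_on_linear_comp k (W' : normedModType R) (phi : {linear W -> W'}) A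
    (f : V -> W) :
  continuous phi -> open A -> Ck_on k A f -> Ck_on k A (fun u => phi (f u)).
Proof.
move=> cphi oA; elim: k f => [|k IH] f [fc fd];
  (split; first by move=> u Au; apply: continuous_comp (fc u Au) (cphi _)) => // v.
have [fv Df] := fd v.
have dphi u : A u -> is_derive u v (fun u => phi (f u)) (phi ('D_v f u)).
  by move=> Au; apply: (is_derive_linear cphi); exact/derivableP/fv.
split=> [u Au|]; first by case: (dphi u Au).
apply: (Ck_on_eq oA _ (IH _ Df)) => u Au.
by apply/esym; exact: (@derive_val _ _ _ _ _ _ _ (dphi u Au)).
Qed.

Lemma smooth_on_linear_comp (W' : normedModType R) (phi : {linear W -> W'}) A
    (f : V -> W) :
  continuous phi -> open A -> smooth_on A f -> smooth_on A (fun u => phi (f u)).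
Proof. by move=> cphi oA sf k; exact: Ck_on_linear_comp. Qed.

Lemma smooth_on_precomp (V' : normedModType R) (l : V' -> V) A (f : V -> W) :
  (forall (h : R) v u, l (h *: v + u) = h *: l v + l u) ->
  continuous l -> open A -> smooth_on A f ->
  smooth_on (l @^-1` A) (fun u => f (l u)).
Proof.
move=> lE cl oA sf k; have oA' : open (l @^-1` A) by exact: open_comp.
elim: k f sf => [|k IH] f sf;
  (split; first by move=> u Au; apply: continuous_comp; [exact: cl|
    exact: smooth_on_continuous sf Au]) => // v.
have dl u : A (l u) -> is_derive u v (fun u => f (l u)) ('D_(l v) f (l u)).
  move=> Au; apply: (is_derive_precomp (fun h => lE h v u)); apply: derivableP.
  exact: smooth_on_derivable sf Au.
split=> [u Au|]; first by case: (dl u Au).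
apply: (Ck_on_eq oA' _ (IH ('D_(l v) f) (smooth_on_derive _ sf))) => u Au.
by apply/esym; exact: (@derive_val _ _ _ _ _ _ _ (dl u Au)).
Qed.

End CkComposition.

(** * Linearity of the derivative in the direction *)

Section DirectionalLinearity.
Variables (R : realType) (V : normedModType R).

Lemma is_derive_dirD (f : V -> R) u v w : derivable f u v ->
  (\near u, derivable f u w) -> {for u, continuous ('D_w f)} ->
  is_derive u (v + w) f ('D_v f u + 'D_w f u).
Proof.
move=> fv fw cw.
suff cv : h^-1 *: ((f \o shift u) (h *: (v + w)) - f u)
    @[h --> 0^'] --> 'D_v f u + 'D_w f u.
  by split; [apply/cvg_ex; exists ('D_v f u + 'D_w f u) | exact: cvg_lim cv].
(* The increment is split at [u + h v]. The first part gives ['D_v f u]; by the mean value theorem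
   the second is ['D_w f] at a point close to [u]. *)
have -> : (fun h : R => h^-1 *: ((f \o shift u) (h *: (v + w)) - f u)) =
   (fun h : R => h^-1 *: ((f \o shift u) (h *: v) - f u)) +
   (fun h : R => h^-1 *: (f (h *: v + u + h *: w) - f (h *: v + u))).
  apply/funext => h; rewrite [RHS]/= -[RHS]scalerDr/=; congr (_ *: _).
  by rewrite [RHS]addrC subrKA scalerDr addrAC.
apply: cvgD; first exact: fv.
apply/cvgrPdist_lt => e e0.
have [d /= d0 dP] : exists2 d : R, 0 < d & forall x, ball u d x ->
    derivable f x w /\ `|'D_w f u - 'D_w f x| < e.
  have /cvgrPdist_lt/(_ _ e0) cwe := cw.
  have : nbhs u [set x | derivable f x w /\ `|'D_w f u - 'D_w f x| < e].
    exact: filterI fw cwe.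
  move=> /nbhs_ballP[d d0 dP].
  by exists d => // x /dP.
near=> h.
have h0 : h != 0 by near: h; exact: nbhs_dnbhs_neq.
(* This bound keeps the segment from [u + h v] to [u + h (v + w)] inside the ball of radius [d]; the
   summand 1 makes the divisor positive. *)
have hd : `|h| * (`|v| + `|w| + 1) < d.
  rewrite -ltr_pdivlMr ?ltr_wpDl ?addr_ge0//.
  near: h; apply: dnbhs0_lt; rewrite divr_gt0// ltr_wpDl ?addr_ge0//.
have inb (t : R) : 0 <= t <= 1 -> ball u d (h *: v + u + t *: (h *: w)).
  move=> /andP[t0 t1]; rewrite -ball_normE/= opprD opprD addrCA addrA subrK.
  rewrite -opprD normrN; apply: le_lt_trans hd.
  rewrite -ler_pdivrMl ?normr_gt0// ler_pdivrMl ?normr_gt0//.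
  apply: le_trans (ler_normD _ _) _; rewrite !normrZ mulrDr mulr1 mulrDr.
  rewrite -addrA lerD2l -[leLHS]addr0 lerD// -[leRHS]mul1r ler_wpM2r ?mulr_ge0//.
  by rewrite ger0_norm.
have [t|t t01 tP] := @segment_MVT _ _ f (h *: v + u) (h *: w).
  by move=> /inb/dP[fx _]; case: (is_derive_dirZ h (derivableP fx)).
have [fx fxe] := dP _ (inb t t01); rewrite tP.
have -> : 'D_(h *: w) f (h *: v + u + t *: (h *: w)) =
    h *: 'D_w f (h *: v + u + t *: (h *: w)).
  by have := is_derive_dirZ h (derivableP fx) => Dw; exact: derive_val.
rewrite [h^-1 *: _]scalerA mulVf// scale1r.
Unshelve. all: by end_near. Qed.

(** Entry by entry, [is_derive_dirD] applies because smoothness makes ['D_w M] continuous. *)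
Lemma C1_derive_linear m n (M : V -> 'M[R]_(m, n)) A u (a : R) v w :
  open A -> smooth_on A M -> A u ->
  'D_(a *: v + w) M u = a *: 'D_v M u + 'D_w M u.
Proof.
move=> oA sM Au.
have dM x z i j : A x -> is_derive x z (fun y => M y i j) ('D_z M x i j).
  move=> Ax; have := derivableP (smooth_on_derivable (v := z) sM Ax).
  by move/is_derive_mxP; apply.
have : is_derive u (a *: v + w) M (a *: 'D_v M u + 'D_w M u).
  apply/is_derive_mxP => i j; rewrite !mxE.
  have avE : is_derive u (a *: v) (fun x => M x i j) (a *: 'D_v M u i j).
    exact/is_derive_dirZ/dM.
  have nA : \near u, A u by exact: open_nbhs_nbhs.
  have wE : 'D_w (fun x => M x i j) u = 'D_w M u i j.
    by have := dM _ w i j Au => ?; exact: derive_val.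
  apply: is_derive_eq.
    apply: is_derive_dirD; first by case: avE.
      by apply: filterS nA => x Ax; case: (dM x w i j Ax).
    have cD : {for u, continuous (fun x => 'D_w M x i j)}.
      apply: (@continuous_comp _ _ _ ('D_w M) (fun N : 'M[R]_(m, n) => N i j)).
        exact: smooth_on_continuous (smooth_on_derive w sM) Au.
      exact: coord_continuous.
    have E : forall x, A x -> 'D_w M x i j = 'D_w (fun x => M x i j) x.
      by move=> x Ax; have := dM _ w i j Ax => ?; apply/esym; exact: derive_val.
    exact: open_eq_continuous oA E Au cD.
  by rewrite wE; congr (_ + _); have := avE => ?; exact: derive_val.
by move=> ?; exact: derive_val.
Qed.

End DirectionalLinearity.

(** * The algebra of upper triangular Toeplitz matrices *)

Section ToeplitzAlgebra.
Variables (R : realType) (n : nat).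
Local Notation N := (shift_mx R n.+1).
Local Notation T := (opU R n).
Local Notation e := (delta_mx ord_max 0 : 'cV[R]_n.+1).
Implicit Types (A B X Y : 'M[R]_n.+1) (u v w : 'cV[R]_n.+1).

Lemma shift_expE k i j : (N ^+ k) i j = (j == (i + k)%N :> nat)%:R.
Proof.
elim: k i j => [|k IH] i j.
  by rewrite expr0 mxE addn0 eq_sym -val_eqE.
rewrite exprSr mxE (eq_bigr (fun l : 'I_n.+1 => ((l == (i + k)%N :> nat) && (j == l.+1 :> nat))%:R)); last first.
  by move=> l _; rewrite IH mxE -natrM mulnb.
case: (ltnP (i + k) n.+1) => [ikn|nik].
  rewrite (bigD1 (Ordinal ikn))//= eqxx/= big1 ?addr0 ?addnS// => l.
  by rewrite -val_eqE/= => /negPf ->.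
rewrite big1 => [|l _].
  by rewrite (_ : (j == (i + k.+1)%N :> nat) = false)//; apply/negbTE; rewrite neq_ltn addnS (leq_trans (ltn_ord j))// ltnW.
by rewrite (_ : (l == (i + k)%N :> nat) = false)//; apply/negbTE; rewrite neq_ltn (leq_trans (ltn_ord l)).
Qed.

Lemma shift_exp_ge k : (n < k)%N -> N ^+ k = 0.
Proof.
move=> nk; apply/matrixP => i j; rewrite shift_expE mxE.
rewrite (_ : (j == _ :> nat) = false)//; apply/negbTE.
by rewrite neq_ltn (leq_trans (ltn_ord j)) ?(leq_trans nk) ?leq_addl.
Qed.

Lemma opU_sumE v : T v = \sum_(k < n.+1) v (rev_ord k) 0 *: N ^+ k.
Proof.
apply/matrixP => i j; rewrite mxE summxE.
under eq_bigr do rewrite mxE shift_expE.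
case: leqP => [ij|ji]; last first.
  by rewrite big1// => k _; rewrite (_ : (j == _ :> nat) = false) ?mulr0//;
    apply/negbTE; rewrite neq_ltn (leq_trans ji) ?leq_addr.
have jin : (j - i < n.+1)%N by rewrite (leq_ltn_trans (leq_subr _ _)).
rewrite (bigD1 (Ordinal jin))//= subnKC// eqxx mulr1 big1 ?addr0 => [|k].
  congr (v _ 0); apply: val_inj; rewrite /= inordK ?subSS//.
  by rewrite ltnS leq_subr.
rewrite -val_eqE/= => kij; rewrite (_ : (j == _ :> nat) = false) ?mulr0//.
by apply/negbTE; apply: contra kij => /eqP ->; rewrite addKn.
Qed.

Lemma opU_linear a v w : T (a *: v + w) = a *: T v + T w.
Proof.
by apply/matrixP => i j; rewrite !mxE; case: ifP; rewrite ?mulr0 ?addr0// !mxE.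
Qed.

HB.instance Definition _ := GRing.isLinear.Build R 'cV[R]_n.+1 'M[R]_n.+1 _ T
  opU_linear.

Lemma opU_e v : T v *m e = v.
Proof.
apply/colP => i; rewrite -colE !mxE leq_ord; congr (v _ 0).
by apply: val_inj; rewrite /= inordK ?ltnS ?leq_subr// subKn// leq_ord.
Qed.

Lemma comm_shift_opU A v : A *m N = N *m A -> A *m T v = T v *m A.
Proof.
move=> AN; rewrite opU_sumE mulmx_sumr mulmx_suml; apply: eq_bigr => k _.
rewrite -scalemxAl -scalemxAr; congr (_ *: _).
have : GRing.comm A N by exact: AN.
by move=> /(commrX k).
Qed.

Lemma opU_shift v : T v *m N = N *m T v.
Proof. by rewrite comm_shift_opU. Qed.

Lemma opU_comm v w : T v *m T w = T w *m T v.
Proof. by apply: comm_shift_opU; exact: opU_shift. Qed.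

(** The vector [e] is cyclic: [A *m e] is the last column of [A], and commutation with [N] expresses
    each column through the next one, so the columns vanish from right to left. *)
Lemma comm_shift_eq0 A : A *m N = N *m A -> A *m e = 0 -> A = 0.
Proof.
move=> AN Ae; suff A0 k (i j : 'I_n.+1) : (j + k = n)%N -> A i j = 0.
  by apply/matrixP => i j; rewrite mxE (A0 (n - j)%N)// subnKC// leq_ord.
elim: k i j => [|k IH] i j jk.
  have /colP/(_ i) := Ae; rewrite -colE !mxE => <-; congr (A i _).
  by apply: val_inj; rewrite addn0 in jk.
have jn : (j.+1 < n.+1)%N.
  by rewrite ltnS -[X in (_ <= X)%N]jk addnS ltnS leq_addr.
have := congr1 (fun B : 'M[R]_n.+1 => B i (Ordinal jn)) AN; rewrite !mxE.
rewrite (bigD1 j)//= mxE/= eqxx mulr1 big1 => [|l lj]; last first.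
  by rewrite mxE/= eqSS eq_sym val_eqE (negPf lj) mulr0.
rewrite addr0 => ->; apply: big1 => l _.
by rewrite (IH l (Ordinal jn)) ?mulr0//= addSnnS.
Qed.

Lemma comm_shift_inj A B : A *m N = N *m A -> B *m N = N *m B ->
  A *m e = B *m e -> A = B.
Proof.
move=> AN BN ABe; apply/eqP; rewrite -subr_eq0; apply/eqP.
apply: comm_shift_eq0; first by rewrite mulmxBl mulmxBr AN BN.
by rewrite mulmxBl ABe subrr.
Qed.

(** Linearity of [T] over the algebra: both sides commute with [N] and take the same value on
    [e]. *)
Lemma opU_mul A v : A *m N = N *m A -> T (A *m v) = A *m T v.
Proof.
move=> AN; apply: comm_shift_inj; rewrite ?opU_shift//.
  by rewrite -mulmxA opU_shift !mulmxA AN.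
by rewrite -mulmxA !opU_e.
Qed.

Lemma opU_e1 : T e = 1%:M.
Proof. by rewrite -[e]mul1mx opU_mul ?mul1mx ?mulmx1// (comm_shift_inj (A := T e) (B := 1%:M)) ?opU_shift ?opU_e ?mul1mx ?mulmx1. Qed.

Lemma opU_unit v : v ord_max 0 != 0 -> T v \in unitmx.
Proof.
(* [det_trig] concerns lower triangular matrices, hence the transpose. *)
move=> v0; rewrite -unitmx_tr unitmxE unitfE det_trig; last first.
  by apply/is_trig_mxP => i j ij; rewrite !mxE leqNgt ij.
apply/prodf_neq0 => i _; rewrite !mxE leqnn subnn subn0.
by rewrite (_ : inord n = ord_max)//; apply: val_inj; rewrite /= inordK.
Qed.

(** Since [v = T v *m e], the vector [A *m v] is [T v *m (A *m e)], and [T v] is invertible. *)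
Lemma comm_shift_kernel A v : A *m N = N *m A -> v ord_max 0 != 0 ->
  A *m v = 0 -> A = 0.
Proof.
move=> AN v0 Av; apply: comm_shift_eq0 => //.
have : T v *m (A *m e) = 0.
  by rewrite mulmxA -(comm_shift_opU v AN) -mulmxA opU_e.
by move/(congr1 (mulmx (invmx (T v)))); rewrite mulKmx ?opU_unit// mulmx0.
Qed.

(** Splits [v] into its scalar part and a part in the image of [N]. The second clause tells when
    [T w] is invertible: its diagonal is the last but one coordinate of [v]. *)
Lemma opU_decomp v : exists w,
  v = v ord_max 0 *: e + N *m w /\
  (forall k : 'I_n.+1, (k.+1 = n)%N -> w ord_max 0 = v k 0).
Proof.
exists (N^T *m v); split=> [|k kn].
  apply/colP => i; rewrite !mxE andbT (_ : (i == ord_max) = (i == n :> nat))//.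
  under eq_bigr do rewrite !mxE.
  case: (ltnP i n) => [lt_in|].
    rewrite (ltn_eqF lt_in) mulr0 add0r.
    have i1 : (i.+1 < n.+1)%N by [].
    rewrite (bigD1 (Ordinal i1))//= eqxx mul1r [X in _ + X]big1 ?addr0 => [|l]; last first.
      by rewrite -val_eqE/= => /negPf ->; rewrite mul0r.
    rewrite (bigD1 i)//= !mxE/= eqxx mul1r big1 ?addr0// => l.
    by rewrite !mxE/= eqSS eq_sym val_eqE => /negPf ->; rewrite mul0r.
  move=> ni; have -> : i = ord_max by apply/val_inj/eqP; rewrite eqn_leq leq_ord.
  rewrite eqxx mulr1 big1 ?addr0// => l _.
  by rewrite (ltn_eqF (ltn_ord l)) mul0r.
rewrite mxE (bigD1 k)//= !mxE kn eqxx mul1r big1 ?addr0// => l.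
by rewrite -val_eqE/= -eqSS kn => lk; rewrite !mxE/= eq_sym (negPf lk) mul0r.
Qed.

(** An induction principle for polynomials in [N]: a subspace containing 1 and stable under [N]
    contains all powers of [N]. *)
Lemma opU_span (S : 'M[R]_n.+1 -> Prop) v : S 1%:M ->
  (forall a X Y, S X -> S Y -> S (a *: X + Y)) ->
  (forall X, S X -> S (N *m X)) -> S (T v).
Proof.
move=> S1 Slin SN; rewrite opU_sumE.
have S0 : S 0 by have := Slin (-1) _ _ S1 S1; rewrite scaleN1r addNr.
apply: big_ind => // [X Y SX SY|k _]; first by have := Slin 1 _ _ SX SY; rewrite scale1r.
rewrite -[_ *: _]addr0; apply: Slin => //.
by elim: (k : nat) => [|l IH]; rewrite ?expr0// exprS; exact: SN.
Qed.

(** The condition under which [T u] generates the same algebra as [N]. In dimension 1 there is no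
    index [k], and [N] is 0. *)
Definition generic u := n = 0%N \/ exists2 k : 'I_n.+1, k.+1 = n & u k 0 != 0.

(* If u^{n-1} <> 0 then U(u) - u^n = N V with V invertible, so that N is a
   polynomial in U(u); the powers N^k are obtained by descending induction. *)
Lemma shift_span (S : 'M[R]_n.+1 -> Prop) u : generic u -> S 1%:M ->
  (forall a X Y, S X -> S Y -> S (a *: X + Y)) ->
  (forall X, S X -> S (T u *m X)) -> S N.
Proof.
move=> gu S1 Slin SU.
have S0 : S 0 by have := Slin (-1) _ _ S1 S1; rewrite scaleN1r addNr.
case: gu => [n0|[k0 kn u0]].
  by rewrite -[N]expr1 shift_exp_ge// n0.
have [y [uE /(_ _ kn) yE]] := opU_decomp u.
set c := u ord_max 0 in uE.
have TuE : T u - c *: 1%:M = N *m T y.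
  by rewrite uE linearD linearZ/= opU_e1 opU_mul// addrC addKr.
have SY k : S ((N *m T y) ^+ k).
  elim: k => [|k IH]; first by rewrite expr0.
  rewrite exprS -{1}TuE mulrBl -scalerAl mul1r addrC -scaleNr.
  by apply: Slin => //; exact: SU.
have YE k : (N *m T y) ^+ k = N ^+ k *m T y ^+ k.
  by rewrite exprMn_comm//; symmetry; exact: opU_shift.
have Tyk k : exists2 z, T y ^+ k = T z & z ord_max 0 != 0.
  elim: k => [|k [z zE z0]].
    by exists e; rewrite ?expr0 ?opU_e1// mxE !eqxx oner_neq0.
  exists (T y *m z); first by rewrite exprS zE [RHS]opU_mul ?opU_shift.
  rewrite mxE (bigD1 ord_max)//= big1 ?addr0 => [|l].
    rewrite mxE leqnn subnn subn0 mulf_neq0// (_ : inord n = ord_max) ?yE//.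
    by apply: val_inj; rewrite /= inordK.
  rewrite -val_eqE/= => ln; rewrite mxE leqNgt ltn_neqAle ln leq_ord.
  by rewrite mul0r.
(* The index [k] measures how far [j] is from an exponent where [N ^+ j] vanishes; [w] is arbitrary
   because the claim is about the whole ideal generated by [N ^+ j]. *)
suff P k j w : (n < j + k)%N -> S (N ^+ j *m T w).
  have := P n 1%N e; rewrite expr1 opU_e1 mulmx1; apply.
  by rewrite add1n.
elim: k j w => [|k IH] j w jk.
  by rewrite shift_exp_ge ?mul0mx//; rewrite addn0 in jk.
have [z zE z0] := Tyk j.
have [z' [zE' _]] := opU_decomp z.
have [w' [wE' _]] := opU_decomp w.
have IH' x : S (N ^+ j.+1 *m T x) by apply: IH; rewrite addSnnS.
(* Modulo the ideal of [N ^+ j.+1], the element [(N *m T y) ^+ j] is a nonzero scalar multiple of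
   [N ^+ j]. *)
have SNj : S (N ^+ j).
  have := SY j; rewrite YE zE zE' linearD linearZ/= opU_e1 opU_mul//.
  rewrite mulmxDr -scalemxAr mulmx1 mulmxA -[N ^+ j *m N]exprSr => Sz.
  have := Slin (- 1) _ _ (IH' z') Sz; rewrite scaleN1r addrC addrK => Sz'.
  have := Slin (z ord_max 0)^-1 _ _ Sz' S0.
  by rewrite scalerA mulVf// scale1r addr0.
rewrite wE' linearD linearZ/= opU_e1 opU_mul//.
rewrite mulmxDr -scalemxAr mulmx1 mulmxA -[N ^+ j *m N]exprSr.
exact: Slin.
Qed.

End ToeplitzAlgebra.

(** * Symmetries as holomorphic maps *)

Section SymmetryCharacterisation.
Variables (R : realType) (n : nat).
Local Notation N := (shift_mx R n.+1).
Local Notation T := (opU R n).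
Local Notation e := (delta_mx ord_max 0 : 'cV[R]_n.+1).
Local Notation field := ('cV[R]_n.+1 -> 'M[R]_n.+1).
Implicit Types (M L : field) (u v w : 'cV[R]_n.+1) (W : set 'cV[R]_n.+1).

Lemma mulmx_continuous p q r (A : 'M[R]_(p, q)) :
  continuous (mulmx A : 'M[R]_(q, r) -> 'M[R]_(p, r)).
Proof.
exact: (@mx_linear_continuous R q r 'M[R]_(p, r) (mulmx A : {linear _ -> _})).
Qed.

Lemma mulmxr_continuous p q r (A : 'M[R]_(q, r)) :
  continuous (mulmxr A : 'M[R]_(p, q) -> 'M[R]_(p, r)).
Proof.
exact: (@mx_linear_continuous R p q 'M[R]_(p, r) (mulmxr A : {linear _ -> _})).
Qed.

Lemma continuous_mulmx_l (V : topologicalType) p q r (A : 'M[R]_(p, q))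
    (F : V -> 'M[R]_(q, r)) (u : V) : {for u, continuous F} ->
  {for u, continuous (fun x => A *m F x)}.
Proof.
move=> cF; apply: (@continuous_comp _ _ _ F (mulmx A)); first exact: cF.
exact: mulmx_continuous.
Qed.

Lemma continuous_mulmx_r (V : topologicalType) p q r (A : 'M[R]_(q, r))
    (F : V -> 'M[R]_(p, q)) (u : V) : {for u, continuous F} ->
  {for u, continuous (fun x => F x *m A)}.
Proof.
move=> cF; apply: (@continuous_comp _ _ _ F (mulmxr A)); first exact: cF.
exact: mulmxr_continuous.
Qed.

(** A point that is not generic is the limit as t tends to 0 of [u] moved by t in its last but one
    coordinate, which is generic for t nonzero; the equality passes to the limit. *)
Lemma generic_dense W p q (F G : 'cV[R]_n.+1 -> 'M[R]_(p, q)) : open W ->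
  (forall u, W u -> {for u, continuous F}) ->
  (forall u, W u -> {for u, continuous G}) ->
  (forall u, W u -> generic u -> F u = G u) ->
  forall u, W u -> F u = G u.
Proof.
move=> oW cF cG FG u Wu.
have [n0|n0] := eqVneq n 0%N; first by apply: FG => //; left.
have kn : (n.-1 < n.+1)%N by rewrite ltnS leq_pred.
pose k := Ordinal kn; have kE : k.+1 = n by rewrite /= prednK// lt0n.
have [uk|uk] := eqVneq (u k 0) 0; last by apply: FG => //; right; exists k.
pose c (t : R) := t *: (delta_mx k 0 : 'cV[R]_n.+1) + u.
have cc : c t @[t --> (0 : R)^'] --> u.
  rewrite -[X in _ --> X]add0r -[X in X + _](scale0r (delta_mx k 0 : 'cV[R]_n.+1)).
  apply: cvgD; last exact: cvg_cst.
  apply: cvgZr_tmp; exact: nbhs_dnbhs.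
have Fc : F (c t) @[t --> (0 : R)^'] --> F u := cvg_comp _ _ cc (cF u Wu).
have Gc : G (c t) @[t --> (0 : R)^'] --> G u := cvg_comp _ _ cc (cG u Wu).
have FGc : F (c t) @[t --> (0 : R)^'] --> G u.
  suff FGt : \forall t \near (0 : R)^', G (c t) = F (c t).
    exact: cvg_trans (near_eq_cvg FGt) Gc.
  near=> t; apply/esym/FG.
    by near: t; exact: cc (open_nbhs_nbhs (conj oW Wu)).
  right; exists k => //; rewrite !mxE uk !eqxx mulr1 addr0.
  by near: t; exact: nbhs_dnbhs_neq.
exact: (cvg_unique _ Fc FGc).
Unshelve. all: by end_near. Qed.

Lemma is_derive_opU u v : is_derive u v T (T v).
Proof.
by apply: (is_derive_linear (phi := T) _ (is_derive_id u v)); exact: mx_linear_continuous.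
Qed.

Lemma opU_continuous : continuous T.
Proof. exact: (mx_linear_continuous (phi := T)). Qed.

(** The derivatives of [xi] cancel because [L] and [M] commute, so the bracket depends only on the
    value [xi u] and can be tested on constant fields. *)
Lemma sym_bracketE L M (xi : 'cV[R]_n.+1 -> 'cV[R]_n.+1) u :
  (forall v, derivable L u v) -> (forall v, derivable M u v) ->
  (forall v, derivable xi u v) -> L u *m M u = M u *m L u ->
  sym_bracket L M xi xi u =
    (L u *m 'D_(xi u) M u - 'D_(L u *m xi u) M u) *m xi u +
    ('D_(M u *m xi u) L u - M u *m 'D_(xi u) L u) *m xi u.
Proof.
move=> dL dM dxi LM.
have DE A v : (forall v, derivable A u v) ->
    'D_v (op_app A xi) u = 'D_v A u *m xi u + A u *m 'D_v xi u.
  move=> dA; have := is_derive_mulmx (derivableP (dA v)) (derivableP (dxi v)).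
  by move=> ?; exact: derive_val.
rewrite /sym_bracket /lie_bracket (DE L (xi u) dL) (DE M (xi u) dM).
rewrite (DE M (op_app L xi u) dM) (DE L (op_app M xi u) dL) /op_app.
move: (xi u) (L u) (M u) LM => x l m lm.
move: ('D_(l *m x) xi u) ('D_x xi u) ('D_(m *m x) xi u) => a b c.
move: ('D_x L u) ('D_x M u) ('D_(l *m x) M u) ('D_(m *m x) L u) => dl dm dlm dml.
rewrite subrr mulmx0 subr0 !mulmxBr !mulmxDr !mulmxBl.
rewrite !mulmxA lm.
move: (m *m a) (m *m dl *m x) (m *m l *m b) (l *m dm *m x) (l *m c).
move: (dlm *m x) (dml *m x) => y1 y2 y3 y4 y5 y6 y7.
by apply/colP => i; rewrite !mxE; ring.
Qed.

(* The algebra R[N] is identified with R^n by T; [holomorphic_on] is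
   holomorphy over this algebra. *)
Definition holomorphic_on W M := [/\ smooth_on W M,
  forall u, W u -> M u *m N = N *m M u &
  forall u, W u -> forall v, 'D_(N *m v) M u = N *m 'D_v M u].

Lemma derive_comm_shift W M u v : open W -> smooth_on W M ->
  (forall u, W u -> M u *m N = N *m M u) -> W u ->
  'D_v M u *m N = N *m 'D_v M u.
Proof.
move=> oW sM MN Wu; have dM := derivableP (smooth_on_derivable (v := v) sM Wu).
have dMN := is_derive_mulmx dM (is_derive_cst N u v).
have dNM := is_derive_mulmx (is_derive_cst N u v) dM.
have := near_eq_is_derive (open_near_eq oW MN Wu) dMN => -[_].
have [_ ->] := dNM.
by rewrite mulmx0 mul0mx addr0 add0r => <-.
Qed.

(** For fixed [w], the matrices [X] that can be pulled out of the direction [X *m w] form a subspace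
    stable under [N]. *)
Lemma holomorphic_on_opU W M u v w : open W -> holomorphic_on W M -> W u ->
  'D_(T v *m w) M u = T v *m 'D_w M u.
Proof.
move=> oW [sM MN hM] Wu.
apply: (@opU_span _ _ (fun X => 'D_(X *m w) M u = X *m 'D_w M u)).
- by rewrite !mul1mx.
- move=> a X Y SX SY; rewrite mulmxDl -scalemxAl (C1_derive_linear _ _ _ oW sM Wu).
  by rewrite SX SY mulmxDl -scalemxAl.
- by move=> X SX; rewrite -(mulmxA N X w) (hM u Wu) SX; exact: mulmxA.
Qed.

(* Vectors with nonzero last component are cyclic for N, and they span. *)
Lemma derive_generic W M u X : open W -> smooth_on W M ->
  (forall u, W u -> M u *m N = N *m M u) -> W u -> X *m N = N *m X ->
  (forall v, (X *m 'D_v M u - 'D_(X *m v) M u) *m v = 0) ->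
  forall v, 'D_(X *m v) M u = X *m 'D_v M u.
Proof.
move=> oW sM MN Wu XN Xv.
have DN v := derive_comm_shift v oW sM MN Wu.
have gen v : v ord_max 0 != 0 -> 'D_(X *m v) M u = X *m 'D_v M u.
  move=> v0; apply/esym/eqP; rewrite -subr_eq0; apply/eqP.
  apply: comm_shift_kernel (Xv v) => //.
  by rewrite mulmxBl mulmxBr -mulmxA DN mulmxA XN -mulmxA DN mulmxA.
move=> v; have [v0|v0] := eqVneq (v ord_max 0) 0; last exact: gen.
have vE : v = (-1) *: e + (v + e) by rewrite scaleN1r addrC addrK.
rewrite {1}[v in LHS]vE mulmxDr -scalemxAr (C1_derive_linear _ _ _ oW sM Wu).
rewrite !gen ?mxE ?v0 ?eqxx ?add0r ?oner_neq0//.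
rewrite scalemxAr -mulmxDr -(C1_derive_linear _ _ _ oW sM Wu) -vE//.
Qed.

(** [N] is constant, so the second term of [sym_bracketE] vanishes; the first is handled by
    [derive_generic]. *)
Lemma symmetry_opN_on W M : open W ->
  symmetry_on (opN R n.+1) M W <-> holomorphic_on W M.
Proof.
move=> oW; split=> [[sM NM bM]|[sM MN hM]].
  have MN u : W u -> M u *m N = N *m M u by move=> /NM ->.
  split=> // u Wu; apply: (derive_generic oW sM MN Wu) => // v.
  have := bM (cst v) (smooth_on_cst W v) u Wu.
  rewrite sym_bracketE ?NM//.
    by rewrite /opN !derive_cst mulmx0 subr0 mul0mx addr0.
  by move=> w; exact: smooth_on_derivable sM Wu.
split=> // [u /MN ->//|xi sxi u Wu].
rewrite sym_bracketE ?MN//; first by rewrite /opN hM// !derive_cst mulmx0 subrr subr0 mul0mx add0r.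
- by move=> w; exact: smooth_on_derivable sM Wu.
- by move=> w; exact: smooth_on_derivable sxi Wu.
Qed.

(** Here ['D_w T u = T w], and the second term of [sym_bracketE] vanishes by [opU_mul]. The
    conditions on [T u] are transferred to [N] at generic points by [shift_span], then everywhere by
    continuity. *)
Lemma symmetry_opU_on W M : open W ->
  symmetry_on (opU R n) M W <-> holomorphic_on W M.
Proof.
move=> oW; split=> [[sM UM bM]|hM].
  have MN u : W u -> M u *m N = N *m M u.
    have cl x : W x -> {for x, continuous (fun u => M u *m N)}.
      by move=> Wx; exact: continuous_mulmx_r (smooth_on_continuous sM Wx).
    have cr x : W x -> {for x, continuous (fun u => N *m M u)}.
      by move=> Wx; exact: continuous_mulmx_l (smooth_on_continuous sM Wx).
    apply: (generic_dense oW cl cr) => {}u Wu.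
    move=> gu; apply: (@shift_span _ _ (fun X => M u *m X = X *m M u) _ gu).
    - by rewrite mulmx1 mul1mx.
    - by move=> a X Y SX SY; rewrite mulmxDr mulmxDl -scalemxAl -scalemxAr SX SY.
    - by move=> X SX; rewrite mulmxA -UM// -mulmxA SX mulmxA.
  have hU u v : W u -> 'D_(T u *m v) M u = T u *m 'D_v M u.
    move=> Wu; apply: (derive_generic oW sM MN Wu (opU_shift u)) => {}v.
    have := bM (cst v) (smooth_on_cst W v) u Wu.
    rewrite sym_bracketE ?UM//.
    - have DT w : 'D_w T u = T w by have := is_derive_opU u w => ?; exact: derive_val.
      by rewrite !DT opU_mul ?MN// subrr mul0mx addr0.
    - by move=> w; case: (is_derive_opU u w).
    - by move=> w; exact: smooth_on_derivable sM Wu.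
  split=> // + + v.
  have cl x : W x -> {for x, continuous ('D_(N *m v) M)}.
    by move=> Wx; exact: smooth_on_continuous (smooth_on_derive _ sM) Wx.
  have cr x : W x -> {for x, continuous (fun u => N *m 'D_v M u)}.
    move=> Wx.
    exact: continuous_mulmx_l (smooth_on_continuous (smooth_on_derive _ sM) Wx).
  apply: (generic_dense oW cl cr) => u Wu.
  move=> gu; apply: (@shift_span _ _
    (fun X => forall w, 'D_(X *m w) M u = X *m 'D_w M u) _ gu).
  - by move=> w; rewrite !mul1mx.
  - move=> a X Y SX SY w; rewrite mulmxDl -scalemxAl (C1_derive_linear _ _ _ oW sM Wu).
    by rewrite SX SY mulmxDl -scalemxAl.
  - by move=> X SX w; rewrite -(mulmxA (T u) X w) (hU u _ Wu) SX; exact: mulmxA.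
have [sM MN _] := hM.
have TM u : W u -> T u *m M u = M u *m T u by move=> Wu; rewrite comm_shift_opU ?MN.
split=> // xi sxi u Wu.
have DT w : 'D_w T u = T w by have := is_derive_opU u w => ?; exact: derive_val.
rewrite sym_bracketE ?TM//.
- by rewrite !DT (holomorphic_on_opU _ _ oW hM Wu) opU_mul ?MN// !subrr !mul0mx addr0.
- by move=> w; case: (is_derive_opU u w).
- by move=> w; exact: smooth_on_derivable sM Wu.
- by move=> w; exact: smooth_on_derivable sxi Wu.
Qed.

End SymmetryCharacterisation.

(** * Functions of U *)

Section OneVariable.
Variable R : realType.
Implicit Types (I : set R) (f g h : R -> R) (p q : {poly R}).

Lemma derive1_funE f : f^`() = 'D_1 f.
Proof. by apply/funext => x; rewrite derive1E. Qed.

Lemma smooth_on_derive1n I h k : smooth_on I h -> smooth_on I (derive1n k h).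
Proof.
elim: k h => [|k IH] h sh; first by rewrite derive1n0.
by rewrite derive1Sn; apply: IH; rewrite derive1_funE; exact: smooth_on_derive.
Qed.

Lemma derive1n_open_eq I f g k : open I -> (forall t, I t -> f t = g t) ->
  forall t, I t -> (derive1n k f) t = (derive1n k g) t.
Proof.
move=> oI; elim: k f g => [|k IH] f g fg t It; first exact: fg.
rewrite !derive1Sn; apply: IH => // s Is; rewrite !derive1E.
by apply: near_eq_derive; exact: open_near_eq oI fg _ Is.
Qed.

Lemma is_derive_derive1n I h k t : smooth_on I h -> I t ->
  is_derive t 1 (derive1n k h) ((derive1n (k.+1) h) t).
Proof.
move=> sh It; rewrite derive1nS derive1E; apply: derivableP.
exact: smooth_on_derivable (smooth_on_derive1n k sh) It.
Qed.

Lemma derive1n_horner p k : (derive1n k (horner p)) = horner (derivn k p).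
Proof.
elim: k p => [|k IH] p; first by rewrite derive1n0 derivn0.
by rewrite derive1Sn derivSn -IH derivE.
Qed.

Lemma smooth_on_horner I p : smooth_on I (horner p).
Proof.
have dD q v : 'D_v (horner q) = horner (v *: deriv q).
  apply/funext => x; rewrite hornerZ.
  have := is_derive_dirZ v (is_derive_poly q x); rewrite [v *: 1]mulr1 => H.
  exact: (@derive_val _ _ _ _ _ _ _ H).
move=> k; elim: k p => [|k IH] p;
  (split; first by move=> t _; exact: continuous_horner) => // v.
rewrite dD; split=> // t _.
by have [+ _] := is_derive_dirZ v (is_derive_poly p t); rewrite [v *: 1]mulr1.
Qed.

(* Faa di Bruno's formula; only the independence of the coefficients b from h
   matters. *)
Lemma derive1n_comp_horner p i : exists b : nat -> {poly R}, forall I h l,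
  open I -> smooth_on I h -> I p.[l] ->
  derive1n i (fun l => h p.[l]) l = \sum_(k < i.+1) (derive1n k h) p.[l] * (b k).[l].
Proof.
elim: i => [|i [b bP]].
  exists (fun=> 1) => I h l _ _ _.
  by rewrite derive1n0 big_ord_recl big_ord0 hornerC mulr1 addr0.
(* Differentiating the term of order k adds the derivative of [b k] to the coefficient of order k
   (product rule) and [b k * deriv p] to that of order k + 1 (chain rule). *)
exists (fun k => (if (k <= i)%N then deriv (b k) else 0) +
                 (if k is k'.+1 then b k' * deriv p else 0)) => I h l oI sh Il.
have oJ : open (horner p @^-1` I).
  by apply: open_comp => // ? _; exact: continuous_horner.
rewrite derive1nS derive1E.
have -> : 'D_1 (derive1n i (fun l => h p.[l])) l =
    'D_1 (\sum_(k < i.+1) (fun l => (derive1n k h) p.[l] * (b k).[l])) l.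
  apply: near_eq_derive; apply: (open_near_eq oJ) => // s Is.
  by rewrite (bP I h s oI sh Is) fct_sumE.
have dk (k : 'I_i.+1) : is_derive l 1 (fun l => (derive1n k h) p.[l] * (b k).[l])
    ((derive1n k h) p.[l] * (deriv (b k)).[l] + (derive1n (k.+1) h) p.[l] * (b k * deriv p).[l]).
  have dp := is_derive_poly p l.
  have dh : is_derive p.[l] 1 (derive1n k h) ((derive1n (k.+1) h) p.[l]) := is_derive_derive1n k sh Il.
  have dc := is_derive1_comp dh dp.
  have dm := is_deriveM dc (is_derive_poly (b k) l).
  by apply: (is_derive_eq dm); rewrite hornerM /GRing.scale/=; ring.
have dS := is_derive_sum dk; rewrite (@derive_val _ _ _ _ _ _ _ dS).
rewrite big_split/=.
under [RHS]eq_bigr do rewrite hornerD mulrDr.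
rewrite [RHS]big_split/=; congr (_ + _).
  rewrite [RHS]big_ord_recr/= ltnn horner0 mulr0 addr0.
  by apply: eq_bigr => k _; rewrite -ltnS ltn_ord.
by rewrite [RHS]big_ord_recl/= horner0 mulr0 add0r.
Qed.

Definition taylor_poly h (t : R) K : {poly R} := \poly_(k < K) ((derive1n k h) t / k`!%:R).

(** By [derive1n_comp_horner] only the derivatives of [h] of order at most [i] at [p.[0]] enter, so
    [h] may be replaced by its Taylor polynomial; for a polynomial the Taylor coefficient at 0 is an
    honest coefficient. *)
Lemma taylor_coef_comp_horner I h p i K : open I -> smooth_on I h ->
  I p.[0] -> (i < K)%N ->
  taylor_coef (fun l => h p.[l]) i =
    (taylor_poly h p.[0] K \Po (p - (p.[0])%:P))`_i.
Proof.
move=> oI sh Ip iK; set t := p.[0] in Ip *.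
set G := taylor_poly h t K; pose g := G \Po ('X - t%:P).
have gE k : derivn k g = (derivn k G) \Po ('X - t%:P).
  elim: k => [|k IH]; first by rewrite !derivn0.
  by rewrite !derivnS IH deriv_comp derivB derivX derivC subr0 mulr1.
have gt k : (k < K)%N -> (derive1n k (horner g)) t = (derive1n k h) t.
  move=> kK; rewrite derive1n_horner gE horner_comp hornerXsubC subrr.
  rewrite horner_coef0 coef_derivn addn0 ffactnn coef_poly kK -[_ *+ _]mulr_natr.
  by rewrite divfK// pnatr_eq0 -lt0n fact_gt0.
have [b bP] := derive1n_comp_horner p i.
rewrite /taylor_coef (bP _ _ _ oI sh Ip) -/t.
have -> : \sum_(k < i.+1) (derive1n k h) t * (b k).[0] =
    derive1n i (fun l => (horner g) p.[l]) 0.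
  rewrite (bP setT _ _ openT (smooth_on_horner _ g))//; apply: eq_bigr => k _.
  by rewrite -/t gt// (leq_trans (ltn_ord k)).
have -> : (fun l => (horner g) p.[l]) = horner (g \Po p).
  by apply/funext => l; rewrite [RHS]horner_comp.
rewrite derive1n_horner horner_coef0 coef_derivn addn0 ffactnn -[_ *+ _]mulr_natr.
rewrite mulfK ?pnatr_eq0 -?lt0n ?fact_gt0//.
by rewrite /g -comp_polyA comp_polyB comp_polyX comp_polyC.
Qed.

Lemma smooth_antiderivative (r : R) h : 0 < r ->
  smooth_on (ball (0 : R) r) h ->
  exists2 F : R -> R, smooth_on (ball (0 : R) (r / 2)) F &
    forall t, ball (0 : R) (r / 2) t -> F^`() t = h t.
Proof.
move=> r0 sh; have r20 : 0 < r / 2 by rewrite divr_gt0.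
have r2r : r / 2 < r by rewrite ltr_pdivrMr// ltr_pMr// ltr1n.
(* Halving the radius keeps the closed interval of integration inside the ball where [h] is
   continuous. *)
pose F x := (\int[lebesgue_measure]_(t in `[- (r / 2), x]) h t)%R.
have hc t : ball (0 : R) r t -> {for t, continuous h}.
  by exact: smooth_on_continuous sh.
have Fd t : ball (0 : R) (r / 2) t -> derivable F t 1 /\ F^`() t = h t.
  rewrite -ball_normE/= sub0r normrN ltr_norml => /andP[at_ tr].
  apply: (@continuous_FTC1_closed _ h (- (r / 2)) t (r / 2)) => //.
    apply: continuous_compact_integrable; first exact: segment_compact.
    apply: continuous_in_subspaceT => s; rewrite inE/= in_itv/= => /andP[s1 s2].
    apply: hc; rewrite -ball_normE/= sub0r normrN ltr_norml.
    by rewrite (le_lt_trans s2)// andbT (lt_le_trans _ s1)// ltrN2.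
  apply: hc; rewrite -ball_normE/= sub0r normrN ltr_norml.
  by rewrite (lt_trans tr)// andbT (lt_trans _ at_)// ltrN2.
exists F => [|t /Fd[]//].
have dF t v : ball (0 : R) (r / 2) t -> is_derive t v F (v *: h t).
  move=> /Fd[Ft Fh]; have := is_derive_dirZ v (derivableP Ft).
  by rewrite -derive1E Fh [v *: 1]mulr1.
have sh' : smooth_on (ball (0 : R) (r / 2)) h.
  by apply: smooth_on_sub sh; exact: le_ball (ltW r2r).
have cF t : ball (0 : R) (r / 2) t -> {for t, continuous F}.
  by move=> /Fd[Ft _]; exact/differentiable_continuous/derivable1_diffP.
case=> [|k]; split=> // v; split=> [t Bt|]; first by case: (dF t v Bt).
have ovh := smooth_on_linear_comp (phi := *:%R v : {linear R^o -> R^o}) (@scaler_continuous _ _ v) (ball_open _ _) sh'.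
apply: Ck_on_eq (ovh k); first exact: ball_open.
by move=> t Bt; apply/esym; exact: (@derive_val _ _ _ _ _ _ _ (dF t v Bt)).
Qed.

End OneVariable.

(** * Continuity and derivatives of matrix-valued maps *)

Section MatrixCalculus.
Variables (R : realType) (V : normedModType R).

Lemma continuous_mx m n (M : V -> 'M[R]_(m, n)) (u : V) :
  (forall i j, {for u, continuous (fun x => M x i j)}) -> {for u, continuous M}.
Proof.
move=> cM; suff : (fun x => \sum_i \sum_j M x i j *: delta_mx i j) @ u -->
    \sum_i \sum_j M u i j *: (delta_mx i j : 'M[R]_(m, n)).
  rewrite -matrix_sum_delta => {}cM; apply: cvg_trans cM.
  by apply: near_eq_cvg; near=> x; rewrite -matrix_sum_delta.
apply: cvg_big => [|i _]; first exact: add_continuous.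
apply: cvg_big => [|j _]; first exact: add_continuous.
by apply: cvgZr_tmp; exact: cM.
Unshelve. all: by end_near. Qed.

Lemma continuous_mulmx m n p (A : V -> 'M[R]_(m, n)) (B : V -> 'M[R]_(n, p)) u :
  {for u, continuous A} -> {for u, continuous B} ->
  {for u, continuous (fun x => A x *m B x)}.
Proof.
move=> cA cB; apply: continuous_mx => i j.
have -> : (fun x => (A x *m B x) i j) = (fun x => \sum_k A x i k * B x k j).
  by apply/funext => x; rewrite mxE.
suff : (fun x => \sum_k A x i k * B x k j) @ u --> \sum_k A u i k * B u k j by [].
apply: cvg_big => [|k _]; first exact: add_continuous.
apply: cvgM.
  exact: (cvg_comp _ _ cA (@coord_continuous _ _ _ i k (A u))).
exact: (cvg_comp _ _ cB (@coord_continuous _ _ _ k j (B u))).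
Qed.

Lemma continuous_sum (W : normedModType R) m (F : 'I_m -> V -> W) (u : V) :
  (forall k, {for u, continuous (F k)}) ->
  {for u, continuous (fun x => \sum_k F k x)}.
Proof.
by move=> cF; apply: cvg_big => [|k _]; [exact: add_continuous|exact: cF].
Qed.

Lemma continuous_scale (W : normedModType R) (f : V -> R) (F : V -> W) (u : V) :
  {for u, continuous f} -> {for u, continuous F} ->
  {for u, continuous (fun x => f x *: F x)}.
Proof. by move=> cf cF; exact: cvgZ. Qed.

Lemma is_derive_scalemx m n (f : V -> R) (M : V -> 'M[R]_(m, n)) u v df dM :
  is_derive u v f df -> is_derive u v M dM ->
  is_derive u v (fun x => f x *: M x) (df *: M u + f u *: dM).
Proof.
move=> fv /is_derive_mxP Mv; apply/is_derive_mxP => i j.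
have -> : (fun x => (f x *: M x) i j) = f * (fun x => M x i j).
  by apply/funext => x; rewrite mxE.
have dm := is_deriveM fv (Mv i j); apply: (is_derive_eq dm).
by rewrite !mxE /GRing.scale/= addrC [M u i j * _]mulrC.
Qed.

End MatrixCalculus.

(** * The expansion of h(U) and its derivative *)

Section FunctionsOfU.
Variables (R : realType) (n : nat).
Local Notation N := (shift_mx R n.+1).
Local Notation T := (opU R n).
Local Notation e := (delta_mx ord_max 0 : 'cV[R]_n.+1).
Local Notation last u := (u ord_max 0).
Implicit Types (u v : 'cV[R]_n.+1) (h : R -> R) (I : set R).

Definition nilp u : 'M[R]_n.+1 := T u - (last u)%:M.

Lemma nilp_linear : linear nilp.
Proof.
move=> a u v; rewrite /nilp linearP/= !mxE (raddfD (@scalar_mx R n.+1))/= -scale_scalar_mx.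
by rewrite scalerBr opprD addrACA.
Qed.
HB.instance Definition _ := GRing.isLinear.Build R 'cV[R]_n.+1 'M[R]_n.+1 _ nilp
  nilp_linear.

Lemma nilp_comm u v : nilp u *m nilp v = nilp v *m nilp u.
Proof.
rewrite /nilp !mulmxBl !mulmxBr opU_comm !mul_mx_scalar !mul_scalar_mx.
rewrite !scale_scalar_mx [last u * _]mulrC !opprB.
by rewrite -!addrA; congr (_ + _); rewrite addrCA [RHS]addrCA; congr (_ + _); rewrite addrC.
Qed.

(** Each [nilp] is a multiple of [N], so a product of [n.+1] of them contains the factor
    [N ^+ n.+1 = 0]. *)
Lemma nilp_expS u v : nilp u ^+ n *m nilp v = 0.
Proof.
have E w : exists z, nilp w = N *m T z.
  have [z [wE _]] := opU_decomp w; exists z.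
  by rewrite /nilp {1}wE linearD linearZ/= opU_e1 opU_mul// scalemx1 addrC addKr.
have [z ->] := E u; have [z' ->] := E v.
rewrite exprMn_comm; last by rewrite /GRing.comm; exact/esym/opU_shift.
rewrite mulmxA -(mulmxA _ (T z ^+ n)).
have -> : T z ^+ n *m N = N *m T z ^+ n.
  by have : GRing.comm N (T z) by [exact/esym/opU_shift]; move=> /(commrX n).
by rewrite mulmxA -[N ^+ n *m N]exprSr shift_exp_ge// !mul0mx.
Qed.

(** Substituting [N] for the parameter in [coord_poly u] gives [T u], hence [nilp u] once the
    constant term is removed. The definition of h(U) thus becomes the Taylor polynomial of [h] at
    the last coordinate, evaluated at [nilp u]. *)
Lemma fun_of_UE I h u : open I -> smooth_on I h -> I (last u) ->
  fun_of_U h u =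
    \sum_(k < n.+1) (derive1n k h (last u) / k`!%:R) *: nilp u ^+ k.
Proof.
move=> oI sh Iu; pose P : {poly R} := \poly_(i < n.+1) u (inord (n - i)) 0.
have PE l : coord_poly u l = P.[l].
  rewrite /coord_poly horner_poly; apply: eq_bigr => i _; rewrite mulrC.
  congr (u _ 0 * _); apply: val_inj; rewrite /= inordK ?subSS//.
  by rewrite ltnS leq_subr.
have P0 : P.[0] = last u.
  rewrite horner_coef0 coef_poly/= subn0; congr (u _ 0).
  by apply: val_inj; rewrite /= inordK.
have NP : horner_mx N P = T u.
  rewrite opU_sumE [P]poly_def rmorph_sum/=; apply: eq_bigr => i _.
  rewrite horner_mxZ rmorphXn/= horner_mx_X; congr (u _ 0 *: _).
  by apply: val_inj; rewrite /= inordK ?subSS// ltnS leq_subr.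
pose G := taylor_poly h (last u) n.+1; pose Q := G \Po (P - (last u)%:P).
have -> : fun_of_U h u = \sum_(i < n.+1) Q`_i *: N ^+ i.
  apply: eq_bigr => i _; congr (_ *: _).
  rewrite (_ : (fun l => _) = (fun l => h P.[l])); last first.
    by apply/funext => l; rewrite PE.
  by rewrite (taylor_coef_comp_horner oI sh _ (ltn_ord i)) P0.
have -> : \sum_(i < n.+1) Q`_i *: N ^+ i = horner_mx N Q.
  rewrite -[Q in RHS]coefK poly_def rmorph_sum/=.
  under [RHS]eq_bigr do rewrite horner_mxZ rmorphXn/= horner_mx_X.
  (* Both sums are extended to a common range: the coefficients vanish from [size Q] on, the powers
     of [N] above [n]. *)
  rewrite (big_ord_widen_cond (maxn n.+1 (size Q)) xpredT (fun i => Q`_i *: N ^+ i)) ?leq_maxl//.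
  rewrite (big_ord_widen_cond (maxn n.+1 (size Q)) xpredT (fun i => Q`_i *: N ^+ i)) ?leq_maxr//.
  rewrite big_mkcond [RHS]big_mkcond/=; apply: eq_bigr => i _.
  case: ltnP => [_|ni]; case: ltnP => // Qi.
    by rewrite nth_default// scale0r.
  by rewrite shift_exp_ge// scaler0.
rewrite /Q comp_polyE rmorph_sum/=.
have NPu : horner_mx N (P - (last u)%:P) = nilp u.
  by rewrite rmorphB/= NP horner_mx_C.
under eq_bigr do rewrite horner_mxZ rmorphXn/= NPu.
rewrite (big_ord_widen_cond n.+1 xpredT (fun i => G`_i *: nilp u ^+ i)) ?size_poly//.
rewrite big_mkcond; apply: eq_bigr => i _ /=.
case: ltnP => Gi; first by rewrite coef_poly ltn_ord.
have := nth_default 0 Gi; rewrite coef_poly ltn_ord => ->.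
by rewrite scale0r.
Qed.

Lemma is_derive_nilp u v : is_derive u v nilp (nilp v).
Proof.
apply: (is_derive_linear (phi := nilp) _ (is_derive_id u v)).
exact: (mx_linear_continuous (phi := nilp)).
Qed.

(** The values of [nilp] commute, so the scalar power rule holds; for [k = 0] the factor 0 hides the
    default value of [k.-1]. *)
Lemma is_derive_nilpX k u v :
  is_derive u v (fun x => nilp x ^+ k) (k%:R *: (nilp u ^+ k.-1 *m nilp v)).
Proof.
elim: k => [|k IH].
  by rewrite scale0r; exact: is_derive_cst.
have -> : (fun x => nilp x ^+ k.+1) = (fun x => nilp x *m nilp x ^+ k).
  by apply/funext => x; rewrite exprS.
apply: (is_derive_eq (is_derive_mulmx (is_derive_nilp u v) IH)).
have comm : nilp v *m nilp u ^+ k = nilp u ^+ k *m nilp v.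
  by have : GRing.comm (nilp v) (nilp u) by [exact: nilp_comm]; move=> /(commrX k).
rewrite comm; case: k {IH comm} => [|k]; first by rewrite scale0r mulmx0 addr0 scale1r.
rewrite -scalemxAr mulmxA -[nilp u *m nilp u ^+ k]exprS /=.
by rewrite -[k.+2%:R]natr1 scalerDl scale1r addrC.
Qed.

Lemma last_preimage_open I : open I ->
  open [set u : 'cV[R]_n.+1 | I (last u)].
Proof. by move=> oI; apply: open_comp => // u _; exact: coord_continuous. Qed.

Lemma is_derive_fun_of_U I h u v : open I -> smooth_on I h -> I (last u) ->
  is_derive u v (fun_of_U h) (fun_of_U (derive1 h) u *m T v).
Proof.
move=> oI sh Iu; have oJ := last_preimage_open oI.
pose c k (x : 'cV[R]_n.+1) := derive1n k h (last x) / k`!%:R.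
pose S := \sum_(k < n.+1) (fun x : 'cV[R]_n.+1 => c k x *: nilp x ^+ k).
have SE (x : 'cV[R]_n.+1) : I (last x) -> S x = fun_of_U h x.
  by move=> Ix; rewrite (fun_of_UE oI sh Ix) /S fct_sumE.
apply: (near_eq_is_derive (open_near_eq oJ SE Iu)).
have dc (k : nat) : is_derive u v (c k) (last v * (derive1n k.+1 h (last u) / k`!%:R)).
  have E : c k = (fun x => (k`!%:R)^-1 *: derive1n k h (last x)).
    by apply/funext => x; rewrite /c mulrC.
  have dl : is_derive (last u) (last v) (derive1n k h) (last v *: derive1n k.+1 h (last u)).
    have := is_derive_dirZ (last v) (is_derive_derive1n k sh Iu).
    by rewrite [last v *: 1]mulr1.
  have dcomp : is_derive u v (fun x => derive1n k h (last x))
      (last v *: derive1n k.+1 h (last u)).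
    by apply: is_derive_precomp dl => t; rewrite !mxE.
  rewrite E; apply: (is_derive_eq (is_deriveZ _ dcomp)).
  by rewrite /GRing.scale/=; ring.
have dS := is_derive_sum (fun k : 'I_n.+1 => is_derive_scalemx (dc k) (is_derive_nilpX k u v)).
apply: (is_derive_eq dS).
have sh' : smooth_on I (derive1 h) by rewrite derive1_funE; exact: smooth_on_derive.
rewrite (fun_of_UE oI sh' Iu) big_split/=.
(* The scalar part of [T v] comes from differentiating the coefficients, the nilpotent part from
   differentiating the powers. *)
have TvE : T v = (last v)%:M + nilp v by rewrite addrC subrK.
rewrite TvE mulmxDr; congr (_ + _).
  rewrite mul_mx_scalar scaler_sumr; apply: eq_bigr => k _.
  by rewrite scalerA -derive1Sn.
(* On the left the term of index 0 vanishes, on the right the top one by [nilp_expS]; the others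
   match after a shift of index. *)
rewrite big_ord_recl scale0r scaler0 add0r big_ord_recr mulmxDl.
rewrite -scalemxAl nilp_expS scaler0 addr0 mulmx_suml; apply: eq_bigr => k _.
rewrite scalerA -scalemxAl -derive1Sn; congr (_ *: _).
by rewrite /c/= /bump/= add1n factS natrM invfM mulrA mulrAC divfK ?pnatr_eq0.
Qed.

Lemma fun_of_U_continuous I h u : open I -> smooth_on I h -> I (last u) ->
  {for u, continuous (fun_of_U h : 'cV[R]_n.+1 -> _)}.
Proof.
move=> oI sh Iu; have oJ := last_preimage_open oI.
pose S (x : 'cV[R]_n.+1) :=
  \sum_(k < n.+1) (derive1n k h (last x) / k`!%:R) *: nilp x ^+ k.
have SE (x : 'cV[R]_n.+1) : I (last x) -> S x = fun_of_U h x.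
  by move=> Ix; rewrite (fun_of_UE oI sh Ix).
apply: (open_eq_continuous oJ SE Iu); apply: continuous_sum => k.
apply: continuous_scale.
  apply: (@continuous_comp _ _ _ (fun x : 'cV[R]_n.+1 => last x)
    (fun t => derive1n k h t / k`!%:R)); first exact: coord_continuous.
  by apply: cvgMr_tmp; exact: (smooth_on_continuous (smooth_on_derive1n k sh) Iu).
have cn : {for u, continuous nilp} by exact: (mx_linear_continuous (phi := nilp)).
elim: (k : nat) => [|j IH].
  exact: (@cst_continuous _ _ (1 : 'M[R]_n.+1)).
have -> : (fun x => nilp x ^+ j.+1) = (fun x => nilp x *m nilp x ^+ j).
  by apply/funext => x; rewrite exprS.
exact: continuous_mulmx cn IH.
Qed.

End FunctionsOfU.

(** * Classification of holomorphic maps *)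

Section Entry.
Variables (R : realType) (m n : nat) (i : 'I_m) (j : 'I_n).

(** The target [R^o] makes taking an entry a linear map between normed modules, as
    [smooth_on_linear_comp] requires. *)
Definition mx_entry (A : 'M[R]_(m, n)) : R^o := A i j.

Lemma mx_entry_linear : linear mx_entry.
Proof. by move=> a A B; rewrite /mx_entry !mxE. Qed.

HB.instance Definition _ := GRing.isLinear.Build R 'M[R]_(m, n) R^o _ mx_entry
  mx_entry_linear.

Lemma smooth_on_entry (V : normedModType R) (A : set V) (M : V -> 'M[R]_(m, n)) :
  open A -> smooth_on A M -> smooth_on A (fun u => M u i j : R).
Proof.
move=> oA; apply: (smooth_on_linear_comp (phi := mx_entry)) => //.
exact: (mx_linear_continuous (phi := mx_entry)).
Qed.

End Entry.

Section Classification.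
Variables (R : realType) (n : nat).
Local Notation N := (shift_mx R n.+1).
Local Notation T := (opU R n).
Local Notation e := (delta_mx ord_max 0 : 'cV[R]_n.+1).
Local Notation last u := (u ord_max 0).
Implicit Types (u v : 'cV[R]_n.+1) (f : 'I_n.+1 -> R -> R) (I : set R).
Implicit Types (M : 'cV[R]_n.+1 -> 'M[R]_n.+1) (W : set 'cV[R]_n.+1).

Lemma comm_shift_exp (A : 'M[R]_n.+1) k :
  A *m N = N *m A -> A *m N ^+ k = N ^+ k *m A.
Proof. by move=> AN; have /(commrX k) : GRing.comm A N by exact: AN. Qed.

Lemma fun_of_U_shift h u : fun_of_U h u *m N = N *m fun_of_U h u.
Proof.
rewrite mulmx_suml mulmx_sumr; apply: eq_bigr => k _.
by rewrite -scalemxAl -scalemxAr -comm_shift_exp.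
Qed.

Lemma sym_of_shift f u : sym_of f u *m N = N *m sym_of f u.
Proof.
rewrite mulmx_suml mulmx_sumr; apply: eq_bigr => k _.
by rewrite mulmxA -fun_of_U_shift -!mulmxA comm_shift_exp.
Qed.

Lemma is_derive_sym_of I f u v : open I -> (forall i, smooth_on I (f i)) ->
  I (last u) ->
  is_derive u v (sym_of f) (sym_of (fun i => derive1 (f i)) u *m T v).
Proof.
move=> oI sf Iu.
have dk (i : 'I_n.+1) := is_derive_mulmx (is_derive_fun_of_U v oI (sf i) Iu)
  (is_derive_cst (N ^+ (n.+1 - i.+1)) u v).
have -> : sym_of f =
    \sum_(i < n.+1) (fun x : 'cV[R]_n.+1 => fun_of_U (f i) x *m N ^+ (n.+1 - i.+1)).
  by apply/funext => x; rewrite fct_sumE.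
apply: (is_derive_eq (is_derive_sum dk)).
rewrite mulmx_suml; apply: eq_bigr => i _; rewrite mulmx0 addr0.
by rewrite -(mulmxA _ (T v)) (comm_shift_exp _ (opU_shift v)) mulmxA.
Qed.

Lemma sym_of_continuous I f u : open I -> (forall i, smooth_on I (f i)) ->
  I (last u) -> {for u, continuous (sym_of f : 'cV[R]_n.+1 -> _)}.
Proof.
move=> oI sf Iu; apply: continuous_sum => i; apply: continuous_mulmx_r.
exact: fun_of_U_continuous oI (sf i) Iu.
Qed.

(** The derivative along [v] is again a [sym_of], times the constant [T v]; the induction therefore
    runs over all families [f] at once. *)
Lemma sym_of_smooth I f : open I -> (forall i, smooth_on I (f i)) ->
  smooth_on [set u : 'cV[R]_n.+1 | I (last u)] (sym_of f).
Proof.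
move=> oI sf k; have oJ := @last_preimage_open R n I oI.
elim: k f sf => [|k IH] f sf;
  (split; first by move=> u; exact: sym_of_continuous oI sf) => // v.
split=> [u Iu|]; first by case: (is_derive_sym_of v oI sf Iu).
have sf' i : smooth_on I (derive1 (f i)).
  by rewrite derive1_funE; exact: smooth_on_derive.
have := Ck_on_linear_comp (@mulmxr_continuous R n.+1 n.+1 n.+1 (T v)) oJ (IH _ sf').
apply: Ck_on_eq => // u Iu; apply/esym.
exact: (@derive_val _ _ _ _ _ _ _ (is_derive_sym_of v oI sf Iu)).
Qed.

Lemma sym_of_holomorphic I f : open I -> (forall i, smooth_on I (f i)) ->
  holomorphic_on [set u : 'cV[R]_n.+1 | I (last u)] (sym_of f).
Proof.
move=> oI sf; split; [exact: sym_of_smooth|by move=> u _; exact: sym_of_shift|].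
move=> u Iu v; rewrite !(@derive_val _ _ _ _ _ _ _ (is_derive_sym_of _ oI sf Iu)).
by rewrite opU_mul// mulmxA sym_of_shift mulmxA.
Qed.

(** On the line through [e] the polynomial [coord_poly] is constant, so only the Taylor coefficient
    of order 0 survives. *)
Lemma fun_of_U_line h (s : R) : fun_of_U h (s *: e) = (h s)%:M.
Proof.
have E : (fun l => h (coord_poly (s *: e) l)) = cst (h s).
  apply/funext => l; congr h; rewrite /coord_poly big_ord_recl big1 => [|i _].
    rewrite expr0 mul1r !mxE (_ : rev_ord ord0 = ord_max) ?eqxx ?mulr1 ?addr0//.
    by apply: val_inj; rewrite /= subn1.
  rewrite !mxE (_ : (_ == ord_max) = false) ?mulr0//.
  by apply/eqP => /(congr1 val); rewrite /= /bump/=; have := ltn_ord i; lia.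
have D k (c : R) : derive1n k.+1 (cst c : R -> R) = cst 0.
  elim: k c => [|k IH] c; rewrite derive1Sn.
    by apply/funext => x; rewrite derive1n0 derive1_cst.
  by rewrite (_ : derive1 _ = cst 0) ?IH//; apply/funext => x; rewrite derive1_cst.
rewrite /fun_of_U big_ord_recl big1 => [|i _].
  by rewrite addr0 expr0 /taylor_coef E derive1n0 fact0 divr1 scalemx1.
by rewrite /taylor_coef E D mul0r scale0r.
Qed.

(** In the last column, row [i] meets only the power of [N] that multiplies [f i]; the parameters
    can thus be read off. *)
Lemma sym_of_line f (s : R) i : sym_of f (s *: e) i ord_max = f i s.
Proof.
rewrite summxE (bigD1 i)//= big1 => [|k ki]; rewrite fun_of_U_line mul_scalar_mx mxE shift_expE.
  by rewrite subSS subnKC ?leq_ord// eqxx mulr1 addr0.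
rewrite subSS (_ : (_ == _) = false) ?mulr0//=; apply/negbTE; apply: contra ki.
move=> /eqP nE; apply/eqP/val_inj => /=; have := leq_ord k; have := leq_ord i.
by move: nE => /=; lia.
Qed.

Lemma norm_cV_ltP (r : R) u : 0 < r ->
  ball (0 : 'cV[R]_n.+1) r u <-> forall i, `|u i 0| < r.
Proof.
move=> r0; rewrite -ball_normE/= sub0r normrN [`|u|]/Num.Def.normr/= mx_normrE.
split=> [/bigmax_ltP[_ ur] i|ur]; first exact: (ur (i, 0)).
by apply/bigmax_ltP; split=> // -[i j] _ /=; rewrite (ord1 j).
Qed.

Lemma ball_last (r : R) u : 0 < r -> ball 0 r u -> ball (0 : R) r (last u).
Proof.
by move=> r0 /(norm_cV_ltP _ r0) ur; rewrite -ball_normE/= sub0r normrN.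
Qed.

Lemma ball_line (r s : R) : 0 < r -> ball (0 : R) r s ->
  ball (0 : 'cV[R]_n.+1) r (s *: e).
Proof.
move=> r0; rewrite -ball_normE/= sub0r normrN => sr; apply/norm_cV_ltP => // i.
rewrite !mxE eqxx andbT; case: eqP => _; first by rewrite mulr1.
by rewrite mulr0 normr0.
Qed.

(* N^j (M1 - M2) is constant along u - u^n e, which lies in the image of N,
   as soon as N^(j+1) (M1 - M2) vanishes. *)
Lemma holomorphic_unique (r : R) M1 M2 :
  let B := ball (0 : 'cV[R]_n.+1) r in 0 < r ->
  holomorphic_on B M1 -> holomorphic_on B M2 ->
  (forall s : R, `|s| < r -> M1 (s *: e) = M2 (s *: e)) ->
  forall u, B u -> M1 u = M2 u.
Proof.
move=> B r0 hM1 hM2 M12.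
have oB : open B by exact: ball_open.
have [sM1 _ _] := hM1; have [sM2 _ _] := hM2.
suff H k : forall u, B u -> N ^+ (n.+1 - k) *m (M1 u - M2 u) = 0.
  move=> u /(H n.+1); rewrite subnn expr0 mul1mx => /eqP.
  by rewrite subr_eq0 => /eqP.
elim: k => [|k IH] u Bu; first by rewrite subn0 shift_exp_ge ?mul0mx.
(* For [k > n] truncated subtraction makes both exponents 0. *)
have [nk|kn] := leqP n.+1 k; first by rewrite (eqP (leqW nk)) -(eqP nk) IH.
rewrite subSS; set j := (n - k)%N in IH *.
have jE : (n.+1 - k = j.+1)%N by rewrite subSn.
rewrite jE in IH.
have dG m x v : B x -> is_derive x v (fun y => N ^+ m *m (M1 y - M2 y))
    (N ^+ m *m ('D_v M1 x - 'D_v M2 x)).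
  move=> Bx; have d1 := derivableP (smooth_on_derivable (v := v) sM1 Bx).
  have d2 := derivableP (smooth_on_derivable (v := v) sM2 Bx).
  apply: (is_derive_eq (is_derive_mulmx (is_derive_cst (N ^+ m) x v) (is_deriveB d1 d2))).
  by rewrite mul0mx add0r.
have [w [uE _]] := opU_decomp u.
(* Balls are cubes for the max norm. Along this segment the last coordinate is fixed and the others
   are scaled by [t]. *)
have Bline (t : R) : 0 <= t <= 1 -> B (last u *: e + t *: (N *m w)).
  move=> /andP[t0 t1]; apply/norm_cV_ltP => // i.
  have /(norm_cV_ltP _ r0)/(_ i) ui := Bu.
  have uEi : u i 0 = (last u *: e + N *m w) i 0 := congr1 (fun z : 'cV[R]_n.+1 => z i 0) uE.
  have lineE c (z : 'cV[R]_n.+1) :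
      (c *: e + z) i 0 = c * (i == ord_max)%:R + z i 0.
    by rewrite !mxE eqxx andbT.
  have scaleE (z : 'cV[R]_n.+1) : (t *: z) i 0 = t * z i 0 by rewrite mxE.
  move: uEi; rewrite !lineE scaleE.
  have [->|_] := eqVneq i ord_max; last first.
    rewrite mulr0 !add0r => <-; rewrite normrM ger0_norm//.
    by rewrite (le_lt_trans _ ui)// ler_piMl.
  rewrite mulr1 => /eqP; rewrite addrC -subr_eq subrr => /eqP <-.
  by rewrite mulr0 addr0; have /(norm_cV_ltP _ r0) := Bu; apply.
(* Holomorphy turns the direction [N *m w] into one more factor [N], and the induction hypothesis
   kills [N ^+ j.+1 *m (M1 y - M2 y)]. *)
have D0 x : B x -> N ^+ j *m ('D_(N *m w) M1 x - 'D_(N *m w) M2 x) = 0.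
  move=> Bx; have [_ _ h1] := hM1; have [_ _ h2] := hM2.
  rewrite h1// h2// -mulmxBr mulmxA -[N ^+ j *m N]exprSr.
  have d0 : is_derive x w (fun y => N ^+ j.+1 *m (M1 y - M2 y)) 0.
    apply: near_eq_is_derive (is_derive_cst (0 : 'M[R]_n.+1) x w).
    by apply: (open_near_eq oB) Bx => y By; rewrite IH.
  rewrite -(@derive_val _ _ _ _ _ _ _ d0).
  by apply/esym; exact: (@derive_val _ _ _ _ _ _ _ (dG j.+1 x w Bx)).
have lu : `|last u| < r by have /(norm_cV_ltP _ r0) := Bu; apply.
apply/matrixP => a b; rewrite [RHS]mxE.
pose g y := (N ^+ j *m (M1 y - M2 y)) a b.
have dg x : B x -> is_derive x (N *m w) g 0.
  move=> Bx; have /is_derive_mxP/(_ a b) := dG j x (N *m w) Bx.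
  by rewrite D0// mxE.
have [t t01|t t01] := @segment_MVT _ _ g (last u *: e) (N *m w).
  by case: (dg _ (Bline _ t01)).
rewrite -uE (@derive_val _ _ _ _ _ _ _ (dg _ (Bline _ t01))) /g => /eqP.
rewrite M12// subrr mulmx0 [X in _ - X]mxE subr0 => /eqP.
by [].
Qed.

Lemma holomorphic_on_sub W W' M : W' `<=` W -> holomorphic_on W M ->
  holomorphic_on W' M.
Proof.
move=> W'W [sM MN hM]; split; first exact: smooth_on_sub sM.
  by move=> u /W'W; exact: MN.
by move=> u /W'W Wu v; exact: hM.
Qed.

Lemma holomorphic_on_eq W M M' : open W -> (forall u, W u -> M u = M' u) ->
  holomorphic_on W M -> holomorphic_on W M'.
Proof.
move=> oW MM' [sM MN hM]; split; first exact: smooth_on_eq sM.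
  by move=> u Wu; rewrite -MM'// MN.
move=> u Wu v; have MM'u := open_near_eq oW MM' Wu.
by rewrite -!(near_eq_derive _ MM'u) hM.
Qed.

(** The [f i] are the last column of [M] on the line through [e]. There [M] and [sym_of f] agree,
    being determined by their last column; [holomorphic_unique] extends the equality to the ball. *)
Lemma holomorphic_sym_of W M : open_nbhs (0 : 'cV[R]_n.+1) W -> holomorphic_on W M ->
  exists (r : R) f, [/\ 0 < r, ball 0 r `<=` W,
    (forall i, smooth_on (ball (0 : R) r) (f i)) &
    forall u, ball 0 r u -> M u = sym_of f u].
Proof.
move=> oW hM; have [oW' W0] := oW.
have /nbhs_ballP[r /= r0 rW] := open_nbhs_nbhs oW.
pose l (s : R) := s *: e; pose f (i : 'I_n.+1) (s : R) := M (l s) i ord_max.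
have lB s : ball (0 : R) r s -> ball 0 r (l s) := ball_line r0.
have sf i : smooth_on (ball (0 : R) r) (f i).
  have cl : continuous l by exact: scalel_continuous.
  have lE (h : R) (v u : R) : l (h *: v + u) = h *: l v + l u.
    by rewrite /l scalerDl scalerA.
  have [sM _ _] := hM.
  have sMl := smooth_on_precomp lE cl oW' sM.
  have oB : open (ball (0 : R) r) by exact: ball_open.
  have sMl' : smooth_on (ball (0 : R) r) (fun s => M (l s)).
    by apply: smooth_on_sub sMl => s /lB/rW.
  exact: smooth_on_entry.
exists r, f; split=> //.
have oB : open (ball (0 : R) r) by exact: ball_open.
have hf := sym_of_holomorphic oB sf.
apply: holomorphic_unique => //.
- exact: holomorphic_on_sub rW hM.
- by apply: holomorphic_on_sub hf => u; exact: ball_last.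
move=> s sr; apply: comm_shift_inj.
- have [_ MN _] := hM; apply: MN; apply: rW; apply: lB.
  by rewrite -ball_normE/= sub0r normrN.
- exact: sym_of_shift.
by apply/colP => i; rewrite -!colE !mxE sym_of_line.
Qed.

End Classification.

(** * Conservation laws *)

Section MoreCalculus.
Variables (R : realType) (V : normedModType R).

Lemma Ck_on_mx k m n A (M : V -> 'M[R]_(m, n)) : open A ->
  (forall i j, Ck_on k A (fun u => M u i j : R)) -> Ck_on k A M.
Proof.
move=> oA; elim: k M => [|k IH] M cM; (split; first by move=> u Au;
  apply: continuous_mx => i j; exact: Ck_on_continuous (cM i j) _ Au) => // v.
have dM u : A u -> is_derive u v M (\matrix_(i, j) 'D_v (fun x => M x i j) u).
  move=> Au; apply/is_derive_mxP => i j; rewrite mxE; apply: derivableP.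
  by have [_ /(_ v)[dv _]] := cM i j; exact: dv.
split=> [u Au|]; first by case: (dM u Au).
apply: (Ck_on_eq (f := fun u => \matrix_(i, j) 'D_v (fun x => M x i j) u)) => //.
  by move=> u Au; apply/esym; exact: (@derive_val _ _ _ _ _ _ _ (dM u Au)).
apply: IH => i j; have [_ /(_ v)[_ Dv]] := cM i j.
by apply: Ck_on_eq Dv => // u Au; rewrite mxE.
Qed.

End MoreCalculus.

Section ConservationLaws.
Variables (R : realType) (n : nat).
Local Notation N := (shift_mx R n.+1).
Local Notation T := (opU R n).
Local Notation e := (delta_mx ord_max 0 : 'cV[R]_n.+1).
Local Notation d_ i := (delta_mx i 0 : 'cV[R]_n.+1).
Local Notation last u := (u ord_max 0).
Implicit Types (u v : 'cV[R]_n.+1) (W : set 'cV[R]_n.+1).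
Implicit Types (alpha : 'cV[R]_n.+1 -> 'rV[R]_n.+1) (L : 'cV[R]_n.+1 -> 'M[R]_n.+1).

Lemma dform_smooth W (f : 'cV[R]_n.+1 -> R) : open W -> smooth_on W f ->
  smooth_on W (dform f).
Proof.
move=> oW sf k; apply: Ck_on_mx => // i j.
have := smooth_on_derive (d_ j) sf k; apply: Ck_on_eq => // u _.
by rewrite mxE.
Qed.

(** Row [i] differentiates along the i-th coordinate, the transpose of the usual Jacobian; for
    [alpha = dform f] it is the Hessian of [f]. *)
Definition jac alpha u : 'M[R]_n.+1 := \matrix_(i, j) ('D_(d_ i) alpha u) 0 j.

Lemma derive_jac W alpha u v : open W -> smooth_on W alpha -> W u ->
  'D_v alpha u = v^T *m jac alpha u.
Proof.
move=> oW sa Wu.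
have D0 : 'D_(0 : 'cV[R]_n.+1) alpha u = 0 by exact: derive0.
have -> : 'D_v alpha u = \sum_i v i 0 *: 'D_(d_ i) alpha u.
  rewrite [v in LHS]matrix_sum_delta.
  under eq_bigr do rewrite big_ord1.
  elim/big_rec2: _ => // i x y _ <-.
  by rewrite (C1_derive_linear _ _ _ oW sa Wu).
by apply/rowP => j; rewrite summxE !mxE; apply: eq_bigr => i _; rewrite !mxE.
Qed.

Lemma jac_continuous W alpha u : smooth_on W alpha -> W u ->
  {for u, continuous (jac alpha)}.
Proof.
move=> sa Wu; apply: continuous_mx => i j.
have -> : (fun x => jac alpha x i j) = (fun x => ('D_(d_ i) alpha x) 0 j).
  by apply/funext => x; rewrite mxE.
apply: (@continuous_comp _ _ _ ('D_(d_ i) alpha) (fun N : 'rV[R]_n.+1 => N 0 j)).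
  exact: smooth_on_continuous (smooth_on_derive _ sa) Wu.
exact: coord_continuous.
Qed.

Lemma closed_formP W alpha : (forall u v, W u -> derivable alpha u v) ->
  closed_form_on alpha W <-> forall u, W u -> (jac alpha u)^T = jac alpha u.
Proof.
move=> dal; have E u i j : W u ->
    partial i (fun x => alpha x 0 j) u = jac alpha u i j.
  move=> Wu; have da := derivableP (dal u (d_ i) Wu).
  move/is_derive_mxP: da => /(_ 0 j) da; rewrite mxE.
  exact: (@derive_val _ _ _ _ _ _ _ da).
split=> H u Wu; last by move=> i j; rewrite !E// -(H u Wu) mxE (H u Wu).
by apply/matrixP => i j; rewrite mxE -!E// H.
Qed.

Lemma jac_op_dual W L alpha u : smooth_on W alpha -> W u ->
  (forall v, derivable L u v) ->
  jac (op_dual L alpha) u =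
    jac alpha u *m L u + \matrix_(i, j) (alpha u *m 'D_(d_ i) L u) 0 j.
Proof.
move=> sa Wu dL; apply/matrixP => i j; rewrite mxE.
have da := derivableP (smooth_on_derivable (v := d_ i) sa Wu).
have dd := is_derive_mulmx da (derivableP (dL (d_ i))).
rewrite (@derive_val _ _ _ _ _ _ _ dd) mxE [RHS]mxE; congr (_ + _).
  by rewrite !mxE; apply: eq_bigr => k _; rewrite mxE.
by rewrite [RHS]mxE.
Qed.

Lemma derivable_op_dual W L alpha u v : smooth_on W alpha -> W u ->
  (forall v, derivable L u v) -> derivable (op_dual L alpha) u v.
Proof.
move=> sa Wu dL; have da := derivableP (smooth_on_derivable (v := v) sa Wu).
by have [] := is_derive_mulmx da (derivableP (dL v)).
Qed.

Lemma closed_opNP W alpha : smooth_on W alpha ->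
  closed_form_on (op_dual (opN R n.+1) alpha) W <->
  forall u, W u -> (jac alpha u *m N)^T = jac alpha u *m N.
Proof.
move=> sa; have dN u v : derivable (opN R n.+1) u v by exact: derivable_cst.
have E u : W u -> jac (op_dual (opN R n.+1) alpha) u = jac alpha u *m N.
  move=> Wu; rewrite (jac_op_dual sa Wu (dN u)) -[RHS]addr0; congr (_ + _).
  by apply/matrixP => i j; rewrite mxE derive_cst mulmx0 !mxE.
split=> [/closed_formP H u Wu|H].
  by rewrite -E// H// => x v Wx; exact: derivable_op_dual sa Wx (dN x).
apply/closed_formP => [x v Wx|u Wu]; first exact: derivable_op_dual sa Wx (dN x).
by rewrite E// H.
Qed.

(** Writing [d_ j] as [T (d_ j) *m e], column [j] of the product becomes a product of commuting
    matrices, symmetric in [i] and [j], applied to [e]. *)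
Lemma opU_delta_sym (A X : 'M[R]_n.+1) i j : A *m N = N *m A -> X *m N = N *m X ->
  forall k, (A *m T (d_ i) *m X) k j = (A *m T (d_ j) *m X) k i.
Proof.
move=> AN XN k; have XT v := comm_shift_opU v XN.
suff : A *m T (d_ i) *m X *m d_ j = A *m T (d_ j) *m X *m d_ i.
  by move=> /colP/(_ k); rewrite -!colE !mxE.
rewrite -{1}(opU_e (d_ j)) -[in RHS](opU_e (d_ i)).
rewrite !mulmxA -(mulmxA _ X) XT -[in RHS](mulmxA _ X) XT !mulmxA.
by rewrite -(mulmxA A) opU_comm !mulmxA.
Qed.

(** The product rule adds the term [S], coming from the derivative of [T]; it is symmetric by
    [opU_delta_sym] and drops out. *)
Lemma closed_opUP W alpha : smooth_on W alpha ->
  closed_form_on (op_dual (opU R n) alpha) W <->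
  forall u, W u -> (jac alpha u *m T u)^T = jac alpha u *m T u.
Proof.
move=> sa; have dU u v : derivable (opU R n) u v by case: (is_derive_opU u v).
pose S u := \matrix_(i, j) (alpha u *m T (d_ i)) 0 j.
have E u : W u -> jac (op_dual (opU R n) alpha) u = jac alpha u *m T u + S u.
  move=> Wu; rewrite (jac_op_dual sa Wu (dU u)); congr (_ + _).
  apply/matrixP => i j; rewrite mxE [RHS]mxE.
  by rewrite (@derive_val _ _ _ _ _ _ _ (is_derive_opU u (d_ i))).
have ST u : (S u)^T = S u.
  apply/matrixP => i j; rewrite !mxE; apply: eq_bigr => k _; congr (_ * _).
  have := @opU_delta_sym 1%:M 1%:M j i _ _ k; rewrite !mul1mx !mulmx1.
  by apply.
split=> [/closed_formP H u Wu|H].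
  have := H (fun x v Wx => derivable_op_dual sa Wx (dU x)) u Wu.
  by rewrite E// linearD/= ST => /addIr.
apply/closed_formP => [x v Wx|u Wu]; first exact: derivable_op_dual sa Wx (dU x).
by rewrite E// linearD/= ST H.
Qed.

(** The matrices commuting with [N] and self-adjoint for the bilinear form [H] form a subspace
    stable under [N]. *)
Lemma shift_sym_opU (H : 'M[R]_n.+1) u : H^T = H ->
  (H *m N)^T = H *m N -> (H *m T u)^T = H *m T u.
Proof.
move=> HT; rewrite !trmx_mul HT => HN.
suff [] : T u *m N = N *m T u /\ (T u)^T *m H = H *m T u by [].
apply: (@opU_span _ _ (fun X => X *m N = N *m X /\ X^T *m H = H *m X)).
- by rewrite trmx1 !mulmx1 !mul1mx.
- move=> a X Y [XN HX] [YN HY].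
  have -> : (a *: X + Y)^T = a *: X^T + Y^T by rewrite linearP.
  rewrite !mulmxDl !mulmxDr.
  by rewrite -!scalemxAl -!scalemxAr XN YN HX HY.
- move=> X [XN HX]; rewrite trmx_mul; split; first by rewrite -mulmxA XN.
  by rewrite -mulmxA HN (mulmxA X^T) HX -mulmxA XN.
Qed.

(** The same argument with [N] and [T u] exchanged, through [shift_span]. *)
Lemma opU_sym_shift (H : 'M[R]_n.+1) u : generic u -> H^T = H ->
  (H *m T u)^T = H *m T u -> (H *m N)^T = H *m N.
Proof.
move=> gu HT; rewrite !trmx_mul HT => HU.
suff [] : N *m T u = T u *m N /\ N^T *m H = H *m N by [].
apply: (@shift_span _ _ (fun X => X *m T u = T u *m X /\ X^T *m H = H *m X) _ gu).
- by rewrite trmx1 !mulmx1 !mul1mx.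
- move=> a X Y [XN HX] [YN HY].
  have -> : (a *: X + Y)^T = a *: X^T + Y^T by rewrite linearP.
  rewrite !mulmxDl !mulmxDr.
  by rewrite -!scalemxAl -!scalemxAr XN YN HX HY.
- move=> X [XN HX]; rewrite trmx_mul; split; first by rewrite -mulmxA XN.
  by rewrite -mulmxA HU (mulmxA X^T) HX -mulmxA XN.
Qed.

Lemma conservation_smooth W L alpha : open W ->
  conservation_law_on L alpha W -> smooth_on W alpha.
Proof.
move=> oW [[f sf af] _ _]; apply: smooth_on_eq (dform_smooth oW sf) => // u Wu.
by rewrite af.
Qed.

Lemma conservation_law_on_equiv W alpha : open W ->
  conservation_law_on (opU R n) alpha W <-> conservation_law_on (opN R n.+1) alpha W.
Proof.
move=> oW; split=> cl; have sa := conservation_smooth oW cl; case: cl => ex cl clL;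
  have da u v : W u -> derivable alpha u v := smooth_on_derivable sa;
  split=> //; move/(closed_formP da) : cl => HT.
- move/(closed_opUP sa) : clL => HU; apply/(closed_opNP sa).
  (* The symmetry of [jac alpha u *m N] is known at generic points only and extends by
     continuity. *)
  have cH u : W u -> {for u, continuous (fun u => jac alpha u *m N)}.
    by move=> Wu; exact: continuous_mulmx_r (jac_continuous sa Wu).
  have cHT u : W u -> {for u, continuous (fun u => N^T *m jac alpha u)}.
    by move=> Wu; exact: continuous_mulmx_l (jac_continuous sa Wu).
  have gE : forall u, W u -> generic u -> N^T *m jac alpha u = jac alpha u *m N.
    move=> u Wu gu; have := opU_sym_shift gu (HT u Wu) (HU u Wu).
    by rewrite trmx_mul HT.
  by move=> u Wu; rewrite trmx_mul HT// (generic_dense oW cHT cH gE Wu).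
- move/(closed_opNP sa) : clL => HN; apply/(closed_opUP sa) => u Wu.
  by apply: shift_sym_opU; [exact: HT|exact: HN].
Qed.

(** Since [T v *m e = v], the last column of [A *m T (d_ i)] is column [i] of [A]: the differential
    of the corner is a first row. *)
Lemma sym_of_entry I f u i : open I -> (forall k, smooth_on I (f k)) ->
  I (last u) ->
  partial i (fun x => sym_of f x ord0 ord_max) u =
    sym_of (fun k => derive1 (f k)) u ord0 i.
Proof.
move=> oI sf Iu; have /is_derive_mxP/(_ ord0 ord_max) dS := is_derive_sym_of (d_ i) oI sf Iu.
rewrite /partial (@derive_val _ _ _ _ _ _ _ dS).
have := congr1 (fun A : 'cV[R]_n.+1 => A ord0 0)
  (mulmxA (sym_of (fun k => derive1 (f k)) u) (T (d_ i)) e).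
by rewrite /= opU_e -!colE [col _ _ _ _]mxE [col _ _ _ _]mxE => ->.
Qed.

Lemma sym_of_conservation (r : R) M f : 0 < r ->
  let B := ball (0 : 'cV[R]_n.+1) r in
  (forall k, smooth_on (ball (0 : R) r) (f k)) ->
  smooth_on B M -> (forall u, B u -> M u = sym_of f u) ->
  conservation_law_on (opN R n.+1) (dform (fun u => M u ord0 ord_max)) B.
Proof.
move=> r0 B sf sM ME; have oB : open B by exact: ball_open.
have oI : open (ball (0 : R) r) by exact: ball_open.
have lB u : B u -> ball (0 : R) r (last u) := ball_last r0.
set alpha := dform _.
have sc : smooth_on B (fun u => M u ord0 ord_max : R) by exact: smooth_on_entry.
have sa : smooth_on B alpha by exact: dform_smooth.
pose S u := sym_of (fun k => derive1 (f k)) u.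
have aE u : B u -> row ord0 (S u) = alpha u.
  move=> Bu; apply/rowP => i; rewrite !mxE -(sym_of_entry _ oI sf (lB u Bu)).
  rewrite /partial; apply: near_eq_derive.
  by apply: (open_near_eq oB) Bu => x Bx; rewrite ME.
have sf' k : smooth_on (ball (0 : R) r) (derive1 (f k)).
  by rewrite derive1_funE; exact: smooth_on_derive.
pose S' u := sym_of (fun k => derive1 (derive1 (f k))) u.
(* Row [i] of the Hessian is the first row of [S' u *m T (d_ i)], so [opU_delta_sym] gives its
   symmetry, also after multiplication by [N]. *)
have jE u i j : B u -> jac alpha u i j = (S' u *m T (d_ i)) ord0 j.
  move=> Bu; rewrite mxE.
  rewrite -(near_eq_derive _ (open_near_eq oB aE Bu)).
  have dS := is_derive_sym_of (d_ i) oI sf' (lB u Bu).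
  have dr : is_derive u (d_ i) (fun x => row ord0 (S x)) (row ord0 (S' u *m T (d_ i))).
    apply/is_derive_mxP => a b; move/is_derive_mxP: dS => /(_ ord0 b) dS.
    rewrite mxE; have -> : (fun x => row ord0 (S x) a b) = (fun x => S x ord0 b).
      by apply/funext => x; rewrite mxE.
    exact: dS.
  by rewrite (@derive_val _ _ _ _ _ _ _ dr) mxE.
have S'N u : S' u *m N = N *m S' u by exact: sym_of_shift.
have da u v : B u -> derivable alpha u v := smooth_on_derivable sa.
split; first by exists (fun u => M u ord0 ord_max).
  apply/(closed_formP da) => u Bu; apply/matrixP => i j; rewrite mxE !jE//.
  have := @opU_delta_sym (S' u) 1%:M j i (S'N u) _ ord0; rewrite !mulmx1.
  by apply; rewrite mul1mx.
apply/(closed_opNP sa) => u Bu.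
have E i j : (jac alpha u *m N) i j = (S' u *m T (d_ i) *m N) ord0 j.
  by rewrite !mxE; apply: eq_bigr => k _; rewrite jE.
by apply/matrixP => i j; rewrite mxE !E opU_delta_sym.
Qed.

(** Reversing the coordinates turns the action of [N] on 1-forms into its action on vectors, so that
    [T] can be applied to a 1-form. *)
Definition rev_col (a : 'rV[R]_n.+1) : 'cV[R]_n.+1 := \col_i a 0 (rev_ord i).

Lemma rev_col_linear : linear rev_col.
Proof. by move=> c a b; apply/colP => i; rewrite !mxE. Qed.
HB.instance Definition _ := GRing.isLinear.Build R 'rV[R]_n.+1 'cV[R]_n.+1 _ rev_col
  rev_col_linear.

Lemma rev_col_shift (a : 'rV[R]_n.+1) : rev_col (a *m N) = N *m rev_col a.
Proof.
apply/colP => i; rewrite !mxE (reindex_inj rev_ord_inj)/=.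
apply: eq_bigr => k _; rewrite !mxE mulrC; congr ((nat_of_bool _)%:R * _).
by have ? := leq_ord i; have ? := leq_ord k; apply/eqP/eqP => /=; lia.
Qed.

Lemma conservation_holomorphic W alpha : open W ->
  conservation_law_on (opN R n.+1) alpha W ->
  holomorphic_on W (fun u => T (rev_col (alpha u))).
Proof.
move=> oW cl; have sa := conservation_smooth oW cl; case: cl => _ clo clN.
have da u v : W u -> derivable alpha u v := smooth_on_derivable sa.
move/(closed_formP da) : clo => HT; move/(closed_opNP sa) : clN => HN.
have crev : continuous rev_col by exact: (mx_linear_continuous (phi := rev_col)).
have cT : continuous T by exact: opU_continuous.
have sr : smooth_on W (fun u => rev_col (alpha u)).
  exact: (smooth_on_linear_comp (phi := rev_col)).
split; first exact: (smooth_on_linear_comp (phi := T)).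
  by move=> u _; exact: opU_shift.
move=> u Wu v.
have D w : 'D_w (fun u => T (rev_col (alpha u))) u = T (rev_col ('D_w alpha u)).
  have d1 := is_derive_linear (phi := rev_col) crev (derivableP (da u w Wu)).
  have d2 := is_derive_linear (phi := T) cT d1.
  exact: (@derive_val _ _ _ _ _ _ _ d2).
(* With H the Jacobian, symmetry of H and of H N gives N^T H = H N, so the derivative of [alpha]
   along [N *m v] is the one along [v] times [N]. *)
rewrite !D -opU_mul// -rev_col_shift !(derive_jac _ oW sa Wu); congr (T (rev_col _)).
by rewrite trmx_mul -!mulmxA -{1}(HT u Wu) -trmx_mul HN.
Qed.

End ConservationLaws.

(** * The clauses of the theorem *)

Section MainSteps.
Variables (R : realType) (n : nat).
Local Notation N := (shift_mx R n.+1).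
Local Notation T := (opU R n).
Local Notation e := (delta_mx ord_max 0 : 'cV[R]_n.+1).
Local Notation last u := (u ord_max 0).
Implicit Types (u v : 'cV[R]_n.+1) (f g : 'I_n.+1 -> R -> R).
Implicit Types (M : 'cV[R]_n.+1 -> 'M[R]_n.+1) (alpha : 'cV[R]_n.+1 -> 'rV[R]_n.+1).

Lemma near_origin_ball (V : normedModType R) (r : R) (P : set V -> Prop) :
  0 < r -> P (ball 0 r) -> near_origin P.
Proof.
move=> r0 Pr; exists (ball 0 r) => //.
by split; [exact: ball_open|exact: ballxx].
Qed.

Lemma near_origin_common (P : 'I_n.+1 -> (R -> R)) :
  (forall i, near_origin (fun I : set R => smooth_on I (P i))) ->
  exists2 r : R, 0 < r & forall i, smooth_on (ball (0 : R) r) (P i).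
Proof.
move=> sP; have /choice[I IP] : forall i, exists I : set R,
    open_nbhs (0 : R) I /\ smooth_on I (P i).
  by move=> i; have [I oI sI] := sP i; exists I.
have : \forall t \near (0 : R), forall i, I i t.
  by apply: (@filter_forall _ _ _ (nbhs (0 : R)) _) => i; exact: open_nbhs_nbhs (IP i).1.
move=> /nbhs_ballP[r /= r0 rI]; exists r => // i.
by apply: (smooth_on_sub _ (IP i).2) => t /rI/(_ i).
Qed.

Lemma symmetry_holomorphic M :
  symmetry (opU R n) M <-> near_origin (fun W => holomorphic_on W M).
Proof.
by split=> -[W oW WM]; exists W => //; apply/(symmetry_opU_on M oW.1).
Qed.

Lemma symmetry_opUN M : symmetry (opU R n) M <-> symmetry (opN R n.+1) M.
Proof.
split=> -[W oW]; exists W => //.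
  by apply/(symmetry_opN_on M oW.1)/(symmetry_opU_on M oW.1).
by apply/(symmetry_opU_on M oW.1)/(symmetry_opN_on M oW.1).
Qed.

Lemma sym_of_ball_holomorphic (r : R) f : 0 < r ->
  (forall i, smooth_on (ball (0 : R) r) (f i)) ->
  holomorphic_on (ball 0 r) (sym_of f).
Proof.
move=> r0 sf; apply: holomorphic_on_sub (sym_of_holomorphic _ sf).
  by move=> u; exact: ball_last.
exact: ball_open.
Qed.

Lemma symmetry_sym_of M : symmetry (opU R n) M <->
  exists2 f : 'I_n.+1 -> R -> R,
    forall i, near_origin (fun I : set R => smooth_on I (f i)) &
    near_origin (fun W : set 'cV[R]_n.+1 => forall u, W u -> M u = sym_of f u).
Proof.
split=> [/symmetry_holomorphic[W oW hM]|[f sf [W oW ME]]].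
  have [r [f [r0 rW sf ME]]] := holomorphic_sym_of oW hM.
  exists f => [i|]; exact: near_origin_ball r0 _.
have [r r0 {}sf] := near_origin_common sf.
have /nbhs_ballP[r' /= r'0 rW] := open_nbhs_nbhs oW.
have m0 : 0 < Num.min r r' by rewrite lt_min r0.
apply/symmetry_holomorphic; apply: (near_origin_ball m0).
apply: (@holomorphic_on_eq _ _ _ (sym_of f)); first exact: ball_open.
  move=> u Bu; rewrite ME//; apply: rW; apply: le_ball Bu.
  by rewrite ge_min lexx orbT.
apply: holomorphic_on_sub (sym_of_ball_holomorphic r0 sf).
by apply: le_ball; rewrite ge_min lexx.
Qed.

Lemma sym_of_inj f g :
  near_origin (fun W : set 'cV[R]_n.+1 => forall u, W u -> sym_of f u = sym_of g u) ->
  forall i, near_origin (fun I : set R => forall t, I t -> f i t = g i t).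
Proof.
move=> [W oW fg] i; have /nbhs_ballP[r /= r0 rW] := open_nbhs_nbhs oW.
apply: (near_origin_ball r0) => t /(ball_line n r0)/rW/fg fgt.
by rewrite -!sym_of_line fgt.
Qed.

Lemma conservation_opUN alpha :
  conservation_law (opU R n) alpha <-> conservation_law (opN R n.+1) alpha.
Proof.
by split=> -[W oW]; exists W => //; apply/(conservation_law_on_equiv alpha oW.1).
Qed.

Lemma symmetry_conservation M : symmetry (opU R n) M ->
  conservation_law (opN R n.+1) (dform (fun u => M u ord0 ord_max)).
Proof.
move=> /symmetry_holomorphic[W oW hM].
have [r [f [r0 rW sf ME]]] := holomorphic_sym_of oW hM.
apply: (near_origin_ball r0); apply: sym_of_conservation r0 sf _ ME.
by have [sM _ _] := hM; exact: smooth_on_sub sM.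
Qed.

(** Read backwards, [alpha] is holomorphic, hence [sym_of h]. Antiderivatives [F] of the [h] give
    the symmetry [sym_of F], whose corner has as differential the first row of [sym_of h]. *)
Lemma conservation_symmetry alpha : conservation_law (opU R n) alpha ->
  exists2 M : 'cV[R]_n.+1 -> 'M[R]_n.+1, symmetry (opU R n) M &
    near_origin (fun W : set 'cV[R]_n.+1 =>
      forall u, W u -> alpha u = dform (fun x => M x ord0 ord_max) u).
Proof.
move=> /conservation_opUN[W oW cl].
have [r [h [r0 rW sh QE]]] :=
  holomorphic_sym_of oW (conservation_holomorphic oW.1 cl).
have /choice[F FP] : forall i, exists F : R -> R,
    smooth_on (ball (0 : R) (r / 2)) F /\
    forall t, ball (0 : R) (r / 2) t -> derive1 F t = h i t.
  by move=> i; have [F sF FE] := smooth_antiderivative r0 (sh i); exists F.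
have r20 : 0 < r / 2 by rewrite divr_gt0.
have oI : open (ball (0 : R) (r / 2)) by exact: ball_open.
have sF i := (FP i).1.
have r2r : r / 2 <= r by rewrite ler_pdivrMr// ler_pMr// ler1n.
exists (sym_of F).
  apply/symmetry_holomorphic; apply: (near_origin_ball r20).
  exact: sym_of_ball_holomorphic.
apply: (near_origin_ball r20) => u Bu; apply/rowP => i.
have lu := ball_last r20 Bu.
rewrite mxE (sym_of_entry _ oI sF lu).
have -> : sym_of (fun k => derive1 (F k)) u = sym_of h u.
  apply: eq_bigr => k _; congr (_ *m _).
  have sF' : smooth_on (ball (0 : R) (r / 2)) (derive1 (F k)).
    by rewrite derive1_funE; exact: smooth_on_derive.
  have sh' : smooth_on (ball (0 : R) (r / 2)) (h k).
    by apply: smooth_on_sub (sh k); exact: le_ball.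
  rewrite (fun_of_UE oI sF' lu) (fun_of_UE oI sh' lu); apply: eq_bigr => j _.
  by rewrite (derive1n_open_eq _ oI (FP k).2 lu).
rewrite -QE; last exact: le_ball Bu.
(* The first row of [T v] lists [v] backwards, which undoes [rev_col]. *)
rewrite !mxE leq0n subn0; congr (alpha u _ _); apply: val_inj => /=.
by rewrite inordK ?ltnS ?leq_subr// subSS subKn// leq_ord.
Qed.

End MainSteps.

Unset Implicit Arguments.
Set Strict Implicit.

Theorem theorem1p4 (R : realType) (n : nat) :
  (* the symmetries of U and of N coincide *)
  (forall M : 'cV[R]_n.+1 -> 'M[R]_n.+1,
     symmetry (opU R n) M <-> symmetry (opN R n.+1) M)
  (* they are exactly the fields f_1(U) N^(n-1) + ... + f_n(U) *)
  /\ (forall M : 'cV[R]_n.+1 -> 'M[R]_n.+1,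
     symmetry (opU R n) M <->
     exists2 f : 'I_n.+1 -> R -> R,
       forall i, near_origin (fun I : set R => smooth_on I (f i)) &
       near_origin (fun W : set 'cV[R]_n.+1 =>
         forall u, W u -> M u = sym_of f u))
  (* and the germs of the parameters f_i are determined by the symmetry *)
  /\ (forall f g : 'I_n.+1 -> R -> R,
     (forall i, near_origin (fun I : set R => smooth_on I (f i))) ->
     (forall i, near_origin (fun I : set R => smooth_on I (g i))) ->
     near_origin (fun W : set 'cV[R]_n.+1 =>
       forall u, W u -> sym_of f u = sym_of g u) ->
     forall i, near_origin (fun I : set R => forall t, I t -> f i t = g i t))
  (* the conservation laws of U and of N coincide *)
  /\ (forall alpha : 'cV[R]_n.+1 -> 'rV[R]_n.+1,
     conservation_law (opU R n) alpha <-> conservation_law (opN R n.+1) alpha)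
  (* the upper right corner of a symmetry yields a conservation law *)
  /\ (forall M : 'cV[R]_n.+1 -> 'M[R]_n.+1, symmetry (opU R n) M ->
     conservation_law (opN R n.+1) (dform (fun u => M u ord0 ord_max)) /\
     conservation_law (opU R n) (dform (fun u => M u ord0 ord_max)))
  (* and every conservation law arises in this way *)
  /\ (forall alpha : 'cV[R]_n.+1 -> 'rV[R]_n.+1,
     conservation_law (opU R n) alpha ->
     exists2 M : 'cV[R]_n.+1 -> 'M[R]_n.+1, symmetry (opU R n) M &
       near_origin (fun W : set 'cV[R]_n.+1 =>
         forall u, W u -> alpha u = dform (fun x => M x ord0 ord_max) u)).
Proof.
split; first exact: symmetry_opUN.
split; first exact: symmetry_sym_of.
split; first by move=> f g _ _; exact: sym_of_inj.
split; first exact: conservation_opUN.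
split; last exact: conservation_symmetry.
move=> M /symmetry_conservation cN; split=> //.
exact/conservation_opUN.
Qed.
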